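(* Let $n\ge 1$ and let $\Pi$ be a triangulation of the once-punctured disc $S_n^1$ with quiddity sequence $q_\Pi=(a_1,a_2,\dots,a_n)$. Then $q_\Pi$ is a quiddity sequence of an infinite frieze $\mathcal{F}_\Pi$ of period $n$; that is, there is an $n$-periodic infinite frieze $\mathcal{F}_\Pi=(m_{ij})_{j-i\ge -2}$ with $m_{ii}=a_i$ for all $i\in\{1,\dots,n\}$.
   Context: Infinite friezes: an infinite frieze is an array $(m_{ij})_{i,j\in\mathbb{Z},\,j-i\ge -2}$ of integers with $m_{i,i-2}=0$ and $m_{i,i-1}=1$ for all $i\in\mathbb{Z}$, $m_{ij}>0$ for all $j\ge i$, and $m_{ij}m_{i+1,j+1}-m_{i+1,j}m_{i,j+1}=1$ for all $j-i\ge -1$. It is $n$-periodic (of period $n$; $n$ need not be minimal) if $m_{ij}=m_{i+n,j+n}$ for all $i\le j$. The quiddity sequence of an $n$-periodic infinite frieze is the $n$-tuple $(m_{11},\dots,m_{nn})$, determined up to cyclic equivalence. Triangulations: for $n\ge 1$, $S_n^1$ is a closed disc with $n$ marked points on the boundary, labeled $1,2,\dots,n$ in clockwise order, and one marked point in the interior, the puncture, labeled $0$. An arc in $S_n^1$ is (the isotopy class of) a non-self-intersecting curve connecting two marked points (possibly equal, in which case it is a loop) which is non-boundary, i.e. not isotopic to a boundary segment between neighboring marked points. The arcs are: the bridging arcs $0j$ connecting the puncture with the boundary marked point $j$; and the peripheral arcs $ij$ ($i,j$ boundary marked points, $i=j$ allowed), where $ij$ is the arc isotopic to the boundary segment going clockwise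 from $i$ to $j$ when all marked points on the boundary other than $i$ and $j$ are ignored. Two arcs are non-crossing if they do not meet in the interior of $S_n^1$ (away from the puncture). A triangulation $\Pi$ of $S_n^1$ is a maximal collection of pairwise non-crossing arcs; it has exactly $n$ arcs and cuts $S_n^1$ into $n$ regions called triangles. The quiddity sequence of $\Pi$ is $q_\Pi=(a_1,\dots,a_n)$, where $a_i$ is the number of connected components of $(S_n^1\setminus\Pi)\cap U$ for $U$ a small neighborhood of the boundary marked point $i$. *)

(* Defs.v *)
From mathcomp Require Import all_boot all_order all_algebra.
From mathcomp Require Import all_classical all_reals all_analysis.

Set Implicit Arguments.
Unset Strict Implicit.
Unset Printing Implicit Defensive.

Import Order.TTheory GRing.Theory Num.Theory.
Import numFieldNormedType.Exports.

Local Open Scope classical_set_scope.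
Local Open Scope ring_scope.

(* An infinite frieze is a total function on pairs of integers of which only the
   entries m i j with j - i >= -2 matter; the others are unconstrained. *)
Definition infinite_frieze (m : int -> int -> int) : Prop :=
  [/\ forall i : int, m i (i - 2) = 0,
      forall i : int, m i (i - 1) = 1,
      forall i j : int, i <= j -> 0 < m i j
    & forall i j : int, -1 <= j - i ->
        m i j * m (i + 1) (j + 1) - m (i + 1) j * m i (j + 1) = 1].

Definition frieze_periodic (n : nat) (m : int -> int -> int) : Prop :=
  forall i j : int, i <= j -> m i j = m (i + n%:Z) (j + n%:Z).

(* The ordinal i : 'I_n is the boundary marked point with label i + 1. *)
Definition frieze_quiddity (n : nat) (m : int -> int -> int) (a : 'I_n -> nat)
    : Prop :=
  forall i : 'I_n, m (i.+1)%:Z (i.+1)%:Z = (a i)%:Z.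

(* Arcs (isotopy classes) are encoded by their names: inl j is the bridging arc
   0j, inr (i, j) is the peripheral curve ij. *)
Definition curve_name (n : nat) := ('I_n + 'I_n * 'I_n)%type.

(* With the boundary marked points unrolled to the integers, the boundary path
   going clockwise from i to j runs from i to clockwise_end i j; for i = j it
   is the whole circle. *)
Definition clockwise_end (n : nat) (i j : 'I_n) : nat :=
  if (i < j)%N then (j : nat) else (j + n)%N.

(* A peripheral curve ij is isotopic to a boundary segment exactly when j is the
   clockwise neighbor of i; for n = 1 this discards the loop at the only
   boundary marked point. *)
Definition is_arc (n : nat) (c : curve_name n) : bool :=
  match c with
  | inl _ => true
  | inr (i, j) => clockwise_end i j != i.+1
  end.

Notation disc_arc n := {c : curve_name n | is_arc c}.

Section PuncturedDisc.
Variables (R : realType) (n : nat).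

(* S_n^1 is the closed unit disc of R x R with puncture at the origin. The point
   polar t r is at distance r from the puncture, in the direction obtained by
   turning clockwise by t / n of a full turn; marked point i is polar i 1. *)
Definition polar (t r : R) : R * R :=
  (r * cos (2 * pi * t / n%:R), - (r * sin (2 * pi * t / n%:R))).

Definition disc : set (R * R) := [set p | p.1 ^+ 2 + p.2 ^+ 2 <= 1].

Definition open_punctured_disc : set (R * R) :=
  [set p | 0 < p.1 ^+ 2 + p.2 ^+ 2 < 1].

(* A curve in the isotopy class of each arc: a radius for 0j; for ij, the
   boundary path from i clockwise to j pushed into the interior, at distance
   1 / (1 + (t - i) (j' - t)) from the puncture in direction t, where j' is
   clockwise_end i j. These representatives are pairwise in minimal position:
   with y = 1 / r - 1, two lifts of peripheral curves to the (t, y)-plane are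
   parabolas with the same leading coefficient, hence meet at most once, and
   they meet at an interior point only if their endpoints interleave; a radius
   lifts to a vertical line. So two arcs have disjoint representatives if and
   only if these ones are disjoint in the interior. *)
Definition curve (c : curve_name n) : set (R * R) :=
  match c with
  | inl j => [set polar j%:R r | r in `[0, 1]]
  | inr (i, j) =>
      [set polar t (1 + (t - i%:R) * ((clockwise_end i j)%:R - t))^-1
         | t in `[i%:R, (clockwise_end i j)%:R]]
  end.

Definition noncrossing (c d : disc_arc n) : Prop :=
  curve (val c) `&` curve (val d) `&` open_punctured_disc = set0.

Definition pairwise_noncrossing (Pi : {set disc_arc n}) : Prop :=
  {in Pi &, forall c d, c != d -> noncrossing c d}.

Definition triangulation (Pi : {set disc_arc n}) : Prop :=
  pairwise_noncrossing Pi /\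
  forall Pi' : {set disc_arc n},
    pairwise_noncrossing Pi' -> Pi \subset Pi' -> Pi' = Pi.

Definition arcs_union (Pi : {set disc_arc n}) : set (R * R) :=
  \bigcup_(c in [set c | c \in Pi]) curve (val c).

(* For e small, these form a basis of neighborhoods of the marked point i in the
   disc. *)
Definition small_nbhd (i : 'I_n) (e : R) : set (R * R) :=
  [set polar t r | t in `]i%:R - e, i%:R + e[ & r in `]1 - e, 1]].

Definition components (A : set (R * R)) : set (set (R * R)) :=
  [set connected_component A p | p in A].

(* The number of components is the same for all small neighborhoods; xget picks
   this number, 0 being a default value that is never used. *)
Definition quiddity (Pi : {set disc_arc n}) (i : 'I_n) : nat :=
  xget 0%N [set k : nat | \forall e \near (0 : R)^'+,
    (components ((disc `\` arcs_union Pi) `&` small_nbhd i e) #= `I_k)%card].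

End PuncturedDisc.

(* Main.v *)
Require Import Defs.
From mathcomp Require Import all_boot all_order all_algebra.
From mathcomp Require Import all_classical all_reals all_analysis.
From mathcomp Require Import zify ring lra.

(** Unroll the boundary to the integers. The arcs of the triangulation, together
    with the boundary segments, become a periodic family of intervals [I, J] with
    J - I <= n and non-interleaving endpoints, and the bridging arcs a periodic
    set B of integers not covered by any of them. Label the k in B by v k = 1 and
    every other k by v k = v l + v r, where [l, r] is the smallest interval over
    k; this is the Conway-Coxeter labelling seen from the puncture. Crossing the
    fan of triangles at k gives v (k - 1) + v (k + 1) = a_k v k. So v is a
    positive solution of the linear recurrence that governs the rows of the
    array with quiddity a, and a Wronskian (Sturm) argument against v shows that
    the entries of that array are positive.

    To read a_k off the topology, use near the marked point i the coordinates
    s = t - i and y = 1 / r - 1. With q = y + s ^ 2, the arcs ending at i are the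
    lines s = c q with c = 1 / L, 0 or - 1 / L, so the components of a small
    neighborhood minus the arcs are the sectors between consecutive slopes c. *)

Set Implicit Arguments.
Unset Strict Implicit.
Unset Printing Implicit Defensive.

Import Order.TTheory GRing.Theory Num.Theory.
Import numFieldNormedType.Exports.

Local Open Scope classical_set_scope.
Local Open Scope ring_scope.

(** * Labels of triangulated strips and positivity *)

(** A triangulation unrolled to a strip: [E] holds the sides, boundary segments included, and [B]
    the boundary ends of the radii. The last clause is maximality: whatever crosses nothing is
    already present. *)
Definition lifted_triangulation (n : nat) (E : int -> int -> bool)
    (B : int -> bool) : Prop :=
  [/\ forall i j, E i j -> i < j <= i + n%:Z,
      forall i, E i (i + 1),
      forall i j k l, E i j -> E k l -> i < k -> k < j -> l <= j,
      forall i j k, E i j -> B k -> i < k -> k < j -> False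
    & (forall i j, i < j -> j <= i + n%:Z ->
        (forall k l, E k l -> ~ (i < k < j /\ j < l) /\ ~ (k < i < l /\ l < j)) ->
        (forall k, B k -> ~ i < k < j) -> E i j)
      /\ (forall k, (forall i j, E i j -> ~ i < k < j) -> B k)].

(** Lengths run from 2 to [n]: length 1 is a boundary segment, which is not an arc, and no lift is
    longer than [n]. *)
Definition right_ends n (E : int -> int -> bool) (k : int) : seq nat :=
  [seq L <- iota 2 n.-1 | E k (k + L%:Z)].
Definition left_ends n (E : int -> int -> bool) (k : int) : seq nat :=
  [seq L <- iota 2 n.-1 | E (k - L%:Z) k].

Definition triangle (E : int -> int -> bool) (l k r : int) : Prop :=
  [/\ E l k, E k r & E l r].

(** Reflecting the strip exchanges left and right, so that the left fan at a vertex follows from the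
    right one. *)
Lemma lifted_triangulation_opp n E B : lifted_triangulation n E B ->
  lifted_triangulation n (fun i j => E (- j) (- i)) (fun k => B (- k)).
Proof.
move=> [E1 E2 E3 E4 [M1 M2]]; split.
- by move=> i j /E1; lia.
- by move=> i; have := E2 (- (i + 1)); rewrite (_ : - (i + 1) + 1 = - i) //; lia.
- move=> i j k l Eij Ekl ik kj; rewrite leNgt; apply/negP => jl.
  by have := E3 _ _ _ _ Ekl Eij; lia.
- by move=> i j k Eij Bk ik kj; apply: (E4 _ _ _ Eij Bk); lia.
- split.
  + move=> i j ij jn H1 H2; apply: M1; [lia|lia| |].
    * move=> k l Ekl; have := H1 (- l) (- k); rewrite !opprK => /(_ Ekl) [].
      by move=> h1 h2; split=> h; [apply: h2|apply: h1]; lia.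
    * by move=> k Bk; have := H2 (- k); rewrite opprK => /(_ Bk); lia.
  + move=> k H; apply: M2 => i j Eij.
    by have := H (- j) (- i); rewrite !opprK => /(_ Eij); lia.
Qed.

Section Labels.
Variables (n : nat) (E : int -> int -> bool) (B : int -> bool).
Hypothesis EB : lifted_triangulation n E B.

Lemma arc_bounds i j : E i j -> i < j <= i + n%:Z.
Proof. by case: EB => h _ _ _ _; apply: h. Qed.

(** By maximality some side covers [k]; take a shortest such [[l, r]]. A side interleaving with
    [[l, k]] or [[k, r]] would either interleave with [[l, r]] or be a shorter side over [k], so
    both are sides by maximality. *)
Lemma triangle_above k : ~~ B k -> exists l r, triangle E l k r.
Proof.
case: EB => E1 E2 E3 E4 [M1 M2] nBk.
have [d [l [r]]] : exists d : nat, exists l r,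
    [/\ E l r, l < k < r & r - l <= d%:Z].
  apply: contrapT => hn; move/negP: nBk; apply; apply: M2 => i j Eij ikj.
  by apply: hn; exists (absz (j - i)%R), i, j; split => //; lia.
elim/ltn_ind: d l r => d IH l r [Elr lkr rld].
have := EM (exists l' r', [/\ E l' r', l' < k < r' & r' - l' < r - l]).
case=> [[l' [r' [El lk rl]]]|nlr].
  by apply: (IH (absz (r' - l')%R) _ l' r') => //; [lia | split=> //; lia].
have /andP[lr rn] := arc_bounds Elr.
exists l, r; split => //; apply: M1; try lia.
- move=> x y Exy; have := arc_bounds Exy; split => h.
  + apply: nlr; exists x, y; have := E3 _ _ _ _ Elr Exy.
    by split => //; lia.
  + by have := E3 _ _ _ _ Exy Elr; lia.
- by move=> b Bb; have := E4 _ _ _ Elr Bb; lia.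
- move=> x y Exy; have := arc_bounds Exy; split => h.
  + by have := E3 _ _ _ _ Elr Exy; lia.
  + apply: nlr; exists x, y; have := E3 _ _ _ _ Exy Elr.
    by split => //; lia.
- by move=> b Bb; have := E4 _ _ _ Elr Bb; lia.
Qed.

Lemma triangle_unique k l r l' r' :
  triangle E l k r -> triangle E l' k r' -> l = l' /\ r = r'.
Proof.
case: EB => E1 E2 E3 E4 [M1 M2] [Elk Ekr Elr] [Elk' Ekr' Elr'].
have := E1 _ _ Elk; have := E1 _ _ Ekr; have := E1 _ _ Elk'; have := E1 _ _ Ekr'.
move=> h1 h2 h3 h4.
have := E3 _ _ _ _ Elk Elr'; have := E3 _ _ _ _ Elk' Elr.
have := E3 _ _ _ _ Elr Ekr'; have := E3 _ _ _ _ Elr' Ekr.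
lia.
Qed.

(** Recursion along chosen triangles: the triangles above [l] and [r] span strictly longer sides
    than [[l, r]], and lengths are at most [n], so the recursion ends at members of [B]. *)
Lemma triangle_label : exists v : int -> int,
  [/\ forall k, 0 < v k, forall k, B k -> v k = 1
    & forall l k r, triangle E l k r -> v k = v l + v r].
Proof.
have [|f fP] := @boolp.choice _ _
    (fun k (y : int * int) => B k \/ triangle E y.1 k y.2).
  move=> k.
  case: (boolP (B k)) => [|/triangle_above [l [r h]]]; first by exists (0, 0); left.
  by exists (l, r); right.
(* [m] is fuel. Running out of it gives 1, which is harmless: with fuel at least the [ht k] defined
   next, this happens only at members of [B]. *)
pose fix vf (m : nat) (k : int) {struct m} : int := if m is m'.+1 then
  if B k then 1 else vf m' (f k).1 + vf m' (f k).2 else 1.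
pose ht k : nat := if B k then 0%N else absz (n%:Z + 1 - ((f k).2 - (f k).1))%R.
have pos m k : 0 < vf m k.
  elim: m k => [//|m IH] k /=; case: ifP => // _.
  by have := IH (f k).1; have := IH (f k).2; lia.
have nB l k r : triangle E l k r -> ~~ B k.
  case: EB => E1 E2 E3 E4 _ [Elk Ekr Elr]; apply/negP => Bk.
  by have := E4 _ _ _ Elr Bk; have := E1 _ _ Elk; have := E1 _ _ Ekr; lia.
have htB k : (ht k <= n)%N.
  rewrite /ht; case: ifP => // Bk; case: (fP k) => [|[h1 h2 h3]]; first by rewrite Bk.
  by have := arc_bounds h3; lia.
have ht_lt k : ~~ B k -> (ht (f k).1 < ht k)%N /\ (ht (f k).2 < ht k)%N.
  case: EB => E1 E2 E3 E4 _.
  move=> /negPf Bk; rewrite /ht Bk; case: (fP k) => [|[h1 h2 h3]]; first by rewrite Bk.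
  have := E1 _ _ h1; have := E1 _ _ h2; have := E1 _ _ h3 => b1 b2 b3.
  split; case: ifP => Bl; try lia.
  - case: (fP (f k).1) => [|[g1 g2 g3]]; first by rewrite Bl.
    have := E1 _ _ g1; have := E1 _ _ g2; have := E1 _ _ g3 => b4 b5 b6.
    have := E3 _ _ _ _ g3 h3; have := E3 _ _ _ _ g3 h2; have := E3 _ _ _ _ g3 h1.
    lia.
  - case: (fP (f k).2) => [|[g1 g2 g3]]; first by rewrite Bl.
    have := E1 _ _ g1; have := E1 _ _ g2; have := E1 _ _ g3 => b4 b5 b6.
    have := E3 _ _ _ _ h3 g3; have := E3 _ _ _ _ h2 g3; have := E3 _ _ _ _ h1 g3.
    lia.
have stable m m' k : (ht k <= m)%N -> (ht k <= m')%N -> vf m k = vf m' k.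
  elim: m m' k => [|m IH] [|m'] k hm hm' //=; case: ifP => // /negbT /[dup] nBk /ht_lt[]; try lia.
  by move=> h1 h2; rewrite (IH m') ?(IH m' (f k).2) //; lia.
exists (vf n); split => [k|k Bk|l k r T] //.
  by case: (n) => //= n'; rewrite Bk.
have nBk := nB _ _ _ T; have [h1 h2] := ht_lt _ nBk.
have -> : vf n k = vf n.+1 k by apply: stable; have := htB k; lia.
rewrite /= (negPf nBk); case: (fP k) => [|T']; first by rewrite (negPf nBk).
by have [-> ->] := triangle_unique T T'.
Qed.

(* Crossing the fan of right arcs at [k] one triangle at a time; [r] is the
   farthest neighbour of [k] reached so far. *)
Lemma right_fan (v : int -> int)
    (vT : forall l k r, triangle E l k r -> v k = v l + v r) k m :
  exists r, [/\ E k r, r <= k + m.+1%:Z,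
      forall x, E k x -> x <= k + m.+1%:Z -> x <= r &
      ((m < n)%N -> v (k + 1) =
        (size [seq L <- iota 2 m | E k (k + L%:Z)])%:Z * v k + v r)].
Proof.
case: EB => E1 E2 E3 E4 [M1 M2].
elim: m => [|m [r [Ekr rm rmax IH]]].
  by exists (k + 1); split => //; rewrite /= mul0r add0r.
case: (boolP (E k (k + m.+2%:Z))) => [Em|nEm]; last first.
  exists r; split => //; first lia.
    move=> x Ekx hx; apply: rmax => //.
    have : x != k + m.+2%:Z by apply: contraNneq nEm => <-.
    by lia.
  rewrite -[m.+1]addn1 iotaD filter_cat size_cat => hm; rewrite IH; last lia.
  by rewrite /= addnC (negPf nEm).
exists (k + m.+2%:Z); split => //.
have b1 := E1 _ _ Ekr; have b2 := E1 _ _ Em.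
rewrite -[m.+1]addn1 iotaD filter_cat size_cat => hm; rewrite IH; last lia.
rewrite /= addnC Em /= (@vT k r (k + m.+2%:Z)); first by rewrite PoszD addn1; ring.
(* The third side [[r, k + m + 2]] is present by maximality: a side interleaving with it but not
   with the other two would start at [k] and end beyond [r], against the choice of [r]. *)
split => //; apply: M1; try lia.
- move=> x y Exy; have := E1 _ _ Exy => b3; split => h.
  + by have := E3 _ _ _ _ Em Exy; lia.
  + have := E3 _ _ _ _ Exy Em; have := E3 _ _ _ _ Ekr Exy => h1 h2.
    have xk : x = k by lia.
    by subst x; have := rmax _ Exy; lia.
- by move=> b Bb; have := E4 _ _ _ Em Bb; lia.
Qed.

End Labels.

(** With [l] and [r] the farthest neighbours of [k], the two fans express [v (k - 1)] and
    [v (k + 1)] as multiples of [v k] plus [v l] and [v r]. If [k] is in [B], so are [l] and [r],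
    and all three labels are 1; otherwise [[l, r]] closes the triangle above [k] and
    [v l + v r = v k]. *)
Lemma label_recurrence n E B (v : int -> int) : (0 < n)%N ->
  lifted_triangulation n E B ->
  (forall k, B k -> v k = 1) ->
  (forall l k r, triangle E l k r -> v k = v l + v r) ->
  forall k, v (k - 1) + v (k + 1) =
    (size (right_ends n E k) + size (left_ends n E k) + B k + 1)%:Z * v k.
Proof.
move=> n0 EB vB vT k.
have [E1 E2 E3 E4 [M1 M2]] := EB.
have [r [Ekr rn rmax]] := right_fan EB vT k n.-1.
have vT' l k0 r0 : triangle (fun i j => E (- j) (- i)) l k0 r0 ->
    v (- k0) = v (- l) + v (- r0).
  by case=> *; rewrite [RHS]addrC; apply: vT.
have [l' [Elk ln lmax]] := right_fan (lifted_triangulation_opp EB) vT' (- k) n.-1.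
rewrite /= !opprK in Elk; set l := - l' in Elk *.
rewrite -/(right_ends n E k) => /(_ ltac:(lia)) vl /(_ ltac:(lia)) vr.
have {}vl : v (k - 1) = (size (left_ends n E k))%:Z * v k + v l.
  rewrite (_ : k - 1 = - (- k + 1)); last by lia.
  rewrite {}vl opprK; congr (_%:Z * _ + _); congr size; apply: eq_filter => L /=.
  by congr E; lia.
rewrite {}vr {}vl.
have {}rmax x : E k x -> x <= r by move=> Ekx; apply: rmax => //; have := E1 _ _ Ekx; lia.
have {}lmax x : E x k -> l <= x.
  move=> Ekx; have := lmax (- x); rewrite !opprK => /(_ Ekx).
  by have := E1 _ _ Ekx; rewrite /l; lia.
have b1 := E1 _ _ Ekr; have b2 := E1 _ _ Elk.
case: (boolP (B k)) => [Bk|nBk].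
  (* A side over [r] would have to start at [k] and reach beyond [r]. *)
  have Br : B r.
    apply: M2 => i j Eij ij; have := E3 _ _ _ _ Ekr Eij; have := E4 _ _ _ Eij Bk => h1 h2.
    have ik : i = k by lia.
    by subst i; have := rmax _ Eij; lia.
  have Bl : B l.
    apply: M2 => i j Eij ij; have := E3 _ _ _ _ Eij Elk; have := E4 _ _ _ Eij Bk => h1 h2.
    have jk : j = k by lia.
    by subst j; have := lmax _ Eij; lia.
  by rewrite !vB //; lia.
have [l0 [r0 T]] := triangle_above EB nBk.
have [T1 T2 T3] := T.
have lE : l = l0.
  have := lmax _ T1; have := E3 _ _ _ _ Elk T3; have := E1 _ _ T1; have := E1 _ _ T2.
  lia.
have rE : r = r0.
  have := rmax _ T2; have := E3 _ _ _ _ T3 Ekr; have := E1 _ _ T1; have := E1 _ _ T2.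
  lia.
by rewrite lE rE (vT _ _ _ T); lia.
Qed.

(** Each row of the array solves the recurrence of [v], shifted by one column, with initial values 0
    and 1. The Wronskian of the row and [v] is a positive constant, so their quotient increases from
    0 and the entries stay positive. *)
Lemma frieze_of_positive_solution (n : nat) (a v : int -> int) :
  (forall k, a (k + n%:Z) = a k) ->
  (forall k, 0 < v k) ->
  (forall k, v (k - 1) + v (k + 1) = a k * v k) ->
  exists m : int -> int -> int,
  [/\ infinite_frieze m, frieze_periodic n m & forall i, m i i = a i].
Proof.
move=> aP v0 va.
(* [u i d] is the pair of entries in row [i], columns [i + d - 2] and
   [i + d - 1]. *)
pose fix u (i : int) (d : nat) {struct d} : int * int := if d is d'.+1 then
  ((u i d').2, a (i + d'%:Z) * (u i d').2 - (u i d').1) else (0, 1).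
pose m i j := (u i (absz (j - i + 2)%R)).1.
have mS i j : i <= j -> m i j = a j * m i (j - 1) - m i (j - 2).
  move=> ij; rewrite /m.
  have [d jE] : exists d : nat, j = i + d%:Z by exists (absz (j - i)%R); lia.
  rewrite (_ : (absz (j - i + 2)%R) = d.+2); last lia.
  rewrite (_ : (absz (j - 1 - i + 2)%R) = d.+1); last lia.
  by rewrite (_ : (absz (j - 2 - i + 2)%R) = d) /= ?jE //; lia.
have m0 i : m i (i - 2) = 0 by rewrite /m (_ : (absz (_)%R) = 0%N) //; lia.
have m1 i : m i (i - 1) = 1 by rewrite /m (_ : (absz (_)%R) = 1%N) //; lia.
(* The Wronskian of the row [i] and [v] does not depend on [d]. *)
have Wpos i (d : nat) : 0 <= m i (i + d%:Z - 2) /\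
    0 < m i (i + d%:Z - 1) * v (i + d%:Z - 1) - m i (i + d%:Z - 2) * v (i + d%:Z).
  elim: d => [|d [IH1 IH2]].
    by rewrite addr0 m0 m1; have := v0 (i - 1); lia.
  have := va (i + d%:Z); have := mS i (i + d%:Z).
  have -> : i + d.+1%:Z - 2 = i + d%:Z - 1 by lia.
  have -> : i + d.+1%:Z - 1 = i + d%:Z by lia.
  have -> : i + d.+1%:Z = i + d%:Z + 1 by lia.
  move=> -> // ; last lia.
  have := v0 (i + d%:Z); have := v0 (i + d%:Z - 1).
  set V := v (i + d%:Z); set V' := v _; set A := a _; set M := m _ _; set M' := m _ _.
  move=> V1 V2 e.
  have -> : (A * M - M') * V - M * v (i + d%:Z + 1) = M * V' - M' * V.
    have -> : v (i + d%:Z + 1) = A * V - V' by rewrite -e; ring.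
    ring.
  by split => //; nia.
exists m; split; first split => //.
- move=> i j ij; have [d jE] : exists d : nat, j = i + d%:Z by exists (absz (j - i)%R); lia.
  have [] := Wpos i d.+1; have [] := Wpos i d.+2.
  have -> : i + d.+2%:Z - 2 = j by lia.
  have -> : i + d.+1%:Z - 2 = j - 1 by lia.
  have -> : i + d.+1%:Z - 1 = j by lia.
  have -> : i + d.+1%:Z = j + 1 by lia.
  have := v0 j; have := v0 (j + 1); nia.
- move=> i j ij; have [d jE] : exists d : nat, j = i - 1 + d%:Z by exists (absz (j - i + 1)%R); lia.
  (* The determinant is the Wronskian of rows [i] and [i + 1]: it does not depend on [j], and at
     [j = i - 1] it is 1 by the border values. *)
  elim: d j jE ij => [|d IH] j jE ij.
    rewrite (_ : j = i - 1) ?addrNK ?subrK ?m1; last lia.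
    rewrite (_ : m (i + 1) i = 1); last by have := m1 (i + 1); rewrite addrK.
    rewrite (_ : m (i + 1) (i - 1) = 0); last by rewrite -[RHS](m0 (i + 1)); congr m; lia.
    by ring.
  have := IH (j - 1) ltac:(lia) ltac:(lia).
  rewrite subrK (mS i (j + 1)) ?(mS (i + 1) (j + 1)); try lia.
  rewrite addrK (_ : j + 1 - 2 = j - 1); last lia.
  by move=> IHj; apply: etrans IHj; ring.
- move=> i j ij; rewrite /m (_ : j + n%:Z - (i + n%:Z) + 2 = j - i + 2); last lia.
  congr (fst _); elim: (absz (_)%R) => //= d ->.
  by congr (_, _ * _ - _); rewrite -(aP (i + d%:Z)); congr a; lia.
- by move=> i; rewrite mS // m1 m0; ring.
Qed.

(** * Lifts of arcs and their crossings *)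

Lemma mulr_gt0_ge0 (R : realFieldType) (a b : R) :
  0 <= a -> 0 <= b -> 0 < a * b -> 0 < a /\ 0 < b.
Proof.
move=> a0 b0 ab; split; rewrite lt0r ?a0 ?b0 andbT; apply: contraTneq ab => ->.
  by rewrite mul0r ltxx.
by rewrite mulr0 ltxx.
Qed.

(** The difference of the two sides is [(k - i) * (j - t) + (t - k) * (j - l)], a sum of nonnegative
    terms in which [j - t] and [t - k] are positive. *)
Lemma nested_parabola_eq (R : realFieldType) (i j k l t : R) :
  i <= k -> k < t -> t < l -> l <= j ->
  (t - i) * (j - t) = (t - k) * (l - t) -> i = k /\ j = l.
Proof.
move=> ik kt tl lj e.
have : (k - i) * (j - t) + (t - k) * (j - l) = 0.
  have -> : (k - i) * (j - t) + (t - k) * (j - l) =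
    (t - i) * (j - t) - (t - k) * (l - t) by ring.
  by rewrite e subrr.
move=> /eqP; rewrite paddr_eq0 ?mulr_ge0 //; try lra.
by rewrite !mulf_eq0 => /andP[/orP[]/eqP h1 /orP[]/eqP h2]; lra.
Qed.

Section Polar.
Variables (R : realType) (n : nat).
Hypothesis n0 : (0 < n)%N.

Lemma cosDint (x : R) (z : int) : cos (x + pi *+ 2 *~ z) = cos x.
Proof.
case: z => m; first by rewrite -pmulrn (periodicn (@cosD2pi R)).
by rewrite NegzE mulrNz -pmulrn -(periodicn (@cosD2pi R) m.+1 (_ - _)) subrK.
Qed.

Lemma sinDint (x : R) (z : int) : sin (x + pi *+ 2 *~ z) = sin x.
Proof.
case: z => m; first by rewrite -pmulrn (periodicn (@sinD2pi R)).
by rewrite NegzE mulrNz -pmulrn -(periodicn (@sinD2pi R) m.+1 (_ - _)) subrK.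
Qed.

Lemma cos_eq1 (x : R) : cos x = 1 -> exists z : int, x = pi *+ 2 *~ z.
Proof.
move=> cx; have p0 := @pi_gt0 R.
(* Rounding to the nearest integer puts [x - 2 pi z] in [[- pi, pi]], where the cosine is 1 only at
   0. *)
set w := x / (pi *+ 2); exists (Num.floor (w + 2^-1)).
set z := Num.floor _.
have /andP[z1 z2] : z%:~R <= w + 2^-1 < (z + 1)%:~R by exact: Num.Theory.floor_itv.
have xE : x = w * (pi *+ 2) by rewrite /w divfK // mulrn_eq0 /= gt_eqF.
pose y := x + pi *+ 2 *~ (- z).
have yE : y = (w - z%:~R) * (pi *+ 2) by rewrite /y xE mulrNz -mulrzl; ring.
have cy : cos `|y| = cos 0 by rewrite cos_norm cosDint cx cos0.
have : `|y| = 0.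
  apply: cos_inj cy; rewrite in_itv /=; last by rewrite lexx ltW.
  rewrite normr_ge0 /=.
  rewrite intrD in z2; rewrite yE ler_norml; apply/andP; split; nra.
by move/eqP; rewrite normr_eq0 /y mulrNz subr_eq0 => /eqP.
Qed.

Lemma polar_angleD (t : R) (z : int) :
  2 * pi * (t + (z * n%:Z)%:~R) / n%:R = 2 * pi * t / n%:R + pi *+ 2 *~ z.
Proof.
rewrite -mulrzl intrM -[n%:Z%:~R]/(n%:R); field.
by rewrite pnatr_eq0 -lt0n.
Qed.

Lemma polar_periodic (t r : R) (z : int) :
  polar n (t + (z * n%:Z)%:~R) r = polar n t r.
Proof. by rewrite /polar polar_angleD cosDint sinDint. Qed.

Lemma polar_sqr (t r : R) : (polar n t r).1 ^+ 2 + (polar n t r).2 ^+ 2 = r ^+ 2.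
Proof.
by rewrite /= sqrrN !exprMn -mulrDr cos2Dsin2 mulr1.
Qed.

Lemma polar_inj (t r t' r' : R) : 0 < r -> 0 < r' ->
  polar n t r = polar n t' r' ->
  r = r' /\ exists z : int, t' = t + (z * n%:Z)%:~R.
Proof.
move=> r0 r'0 e.
have rr : r = r'.
  have /eqP : r ^+ 2 = r' ^+ 2 by rewrite -[LHS](polar_sqr t) e polar_sqr.
  by rewrite eqrXn2 ?ltW // => /eqP.
split => //; subst r'; case: e => /(mulfI (lt0r_neq0 r0)) ec.
move=> /oppr_inj/(mulfI (lt0r_neq0 r0)) es.
have : cos (2 * pi * t' / n%:R - 2 * pi * t / n%:R) = 1.
  by rewrite cosB ec es -!expr2 cos2Dsin2.
move=> /cos_eq1 [z ez]; exists z.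
have nn : n%:R != 0 :> R by rewrite pnatr_eq0 -lt0n.
have pn : 2 * pi != 0 :> R by rewrite mulf_neq0 // gt_eqF // pi_gt0.
have : 2 * pi * t' / n%:R = 2 * pi * (t + (z * n%:Z)%:~R) / n%:R.
  by rewrite polar_angleD -ez; ring.
by move=> /(mulIf (invr_neq0 nn)) /(mulfI pn).
Qed.

End Polar.

Section Lifts.
Variables (R : realType) (n : nat).
Hypothesis n0 : (0 < n)%N.

(* A radius is treated as the degenerate interval [k, k]. *)
Definition lifts (c : curve_name n) (I J : int) : Prop :=
  match c with
  | inl j => I = J /\ exists z : int, I = (j : nat)%:Z + z * n%:Z
  | inr (i, j) => exists z : int, I = (i : nat)%:Z + z * n%:Z /\
                   J = (clockwise_end i j)%:Z + z * n%:Z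
  end.

Lemma liftsD c I J (z : int) :
  lifts c I J -> lifts c (I + z * n%:Z) (J + z * n%:Z).
Proof.
case: c => [j [-> [z' ->]]|[i j] [z' [-> ->]]]; first by split => //; exists (z' + z); lia.
by exists (z' + z); lia.
Qed.

Lemma clockwise_end_bounds (i j : 'I_n) : (i < clockwise_end i j <= i + n)%N.
Proof.
have hi := ltn_ord i; have hj := ltn_ord j.
by rewrite /clockwise_end; case: (ltnP i j); lia.
Qed.

Lemma lifts_le c I J : lifts c I J -> I <= J <= I + n%:Z.
Proof.
case: c => [j [-> _]|[i j] [z' [-> ->]]]; first by lia.
by have := clockwise_end_bounds i j; lia.
Qed.

Lemma lift_inj (i j : 'I_n) (y z : int) :
  (i : nat)%:Z + y * n%:Z = (j : nat)%:Z + z * n%:Z -> i = j /\ y = z.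
Proof.
move=> e; have li := ltn_ord i; have lj := ltn_ord j.
have yz : y = z by nia.
by split => //; apply: val_inj; subst z => /=; lia.
Qed.

Lemma lifts_inj c d I J : lifts c I J -> lifts d I J -> c = d.
Proof.
case: c => [j [-> [z' ->]]|[i j] [z' [-> ->]]]; case: d => [k|[k l]] /=.
- by case=> _ [z /lift_inj [-> _]].
- by case=> z [-> ]; have := clockwise_end_bounds k l; lia.
- by case=> h _; have := clockwise_end_bounds i j; lia.
case=> z [/lift_inj [<- <-]] /addIr; rewrite /clockwise_end => h.
congr (inr (_, _)); apply: val_inj => /=.
have hj := ltn_ord j; have hl := ltn_ord l.
by move: h; case: (ltnP i j); case: (ltnP i l); lia.
Qed.

Lemma ord_lift (k : int) : exists (i : 'I_n) (z : int), k = (i : nat)%:Z + z * n%:Z.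
Proof.
have n1 : n%:Z != 0 by lia.
have h : (absz (k %% n%:Z)%Z < n)%N.
  by have := ltz_pmod k (d := n%:Z) ltac:(lia); have := modz_ge0 k n1; lia.
exists (Ordinal h), (k %/ n%:Z)%Z; rewrite /= gez0_abs ?modz_ge0 //.
by rewrite addrC -divz_eq.
Qed.

Lemma exists_lift_radius (k : int) : exists c : disc_arc n, lifts (val c) k k.
Proof. by have [i h] := ord_lift k; exists (exist _ (inl i) isT). Qed.

Lemma exists_lift_peripheral (I J : int) : I + 1 < J -> J <= I + n%:Z ->
  exists c : disc_arc n, lifts (val c) I J.
Proof.
move=> IJ Jn; have [i [z Iz]] := ord_lift I; have [j [y Jy]] := ord_lift J.
(* [J] lies in the same period block as [I] or in the next one; these are the two cases of
   [clockwise_end]. *)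
have Je : J = (clockwise_end i j)%:Z + z * n%:Z.
  have hi := ltn_ord i; have hj := ltn_ord j; rewrite /clockwise_end.
  case: (ltnP i j) => ij.
    by rewrite Jy (_ : y = z) //; nia.
  by rewrite Jy (_ : y = z + 1); [lia|nia].
have h : is_arc (inr (i, j)) by rewrite /is_arc /=; apply/eqP; lia.
by exists (exist _ (inr (i, j)) h), z.
Qed.

(** Any single lift describes the whole curve, since translating [t] by multiples of [n] does not
    change [polar]. The puncture is excluded: it lies on every radius but has no positive [r]. *)
Lemma lifts_curve c I J (p : R * R) : lifts c I J -> p != 0 ->
  curve c p <-> exists t r : R, [/\ 0 < r <= 1, p = polar n t r,
    I%:~R <= t <= J%:~R & I = J \/ r^-1 = 1 + (t - I%:~R) * (J%:~R - t)].
Proof.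
move=> cIJ p0; split.
- case: c cIJ => [j [<- [z Iz]] [r /= + pE]|[i j] [z [Iz Jz]] [t /= + pE]].
    rewrite in_itv /= => /andP[r0 r1].
    exists I%:~R, r; split; rewrite ?lexx //; last by left.
      rewrite r1 lt0r r0 !andbT; apply: contraNneq p0 => r00.
      by rewrite -pE r00 /polar !mul0r oppr0.
    by rewrite Iz intrD polar_periodic.
  rewrite in_itv /= => /andP[ti tj].
  have g0 : 0 <= (t - i%:R) * ((clockwise_end i j)%:R - t).
    by rewrite mulr_ge0 // subr_ge0.
  exists (t + (z * n%:Z)%:~R), (1 + (t - i%:R) * ((clockwise_end i j)%:R - t))^-1.
  have eI : I%:~R = i%:R + (z * n%:Z)%:~R :> R by rewrite Iz intrD.
  have eJ : J%:~R = (clockwise_end i j)%:R + (z * n%:Z)%:~R :> R by rewrite Jz intrD.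
  split.
  + by rewrite invr_gt0 invf_le1; lra.
  + by rewrite polar_periodic.
  + by rewrite eI eJ !lerD2r ti.
  + by right; rewrite invrK eI eJ; ring.
- case=> t [r [/andP[r0 r1] pE /andP[It tJ] tr]].
  case: c cIJ => [j [IJ [z Iz]]|[i j] [z [Iz Jz]]] /=.
    exists r; first by rewrite /= in_itv /= ltW.
    have -> : p = polar n I%:~R r.
      by rewrite pE; congr polar; apply/eqP; rewrite eq_le It -IJ andbT in tJ *; rewrite IJ in tJ *; exact: tJ.
    by rewrite Iz intrD polar_periodic.
  have eI : I%:~R = i%:R + (z * n%:Z)%:~R :> R by rewrite Iz intrD.
  have eJ : J%:~R = (clockwise_end i j)%:R + (z * n%:Z)%:~R :> R by rewrite Jz intrD.
  case: tr => [IJ|tr]; first by have := clockwise_end_bounds i j; lia.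
  exists (t - (z * n%:Z)%:~R); first by rewrite /= in_itv /=; apply/andP; split; lra.
  rewrite pE -(polar_periodic n0 (t - _) _ z) subrK; congr polar.
  rewrite -[RHS]invrK tr eI eJ; congr (_^-1); ring.
Qed.

(** The case [K = L] is a radius standing strictly inside [[I, J]]. *)
Definition interleave (I J K L : int) : Prop := I < K < J /\ (K = L \/ J < L).
Definition crossing (I J K L : int) : Prop :=
  interleave I J K L \/ interleave K L I J.

Lemma open_punctured_polar (t r : R) :
  0 < r -> open_punctured_disc (polar n t r) <-> r < 1.
Proof.
move=> r0; rewrite /open_punctured_disc /= sqrrN !exprMn -mulrDr cos2Dsin2 mulr1.
by rewrite exprn_gt0 //= expr_lt1 // ltW.
Qed.

Lemma open_punctured_neq0 (p : R * R) : open_punctured_disc p -> p != 0.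
Proof.
move=> /= /andP[p0 _]; apply: contraTneq p0 => ->.
by rewrite /= expr0n /= addr0 ltxx.
Qed.

Lemma crossing_nested I J K L : I < L -> K < J -> ~ crossing I J K L ->
  (I <= K /\ L <= J) \/ (K <= I /\ J <= L).
Proof.
move=> IL KJ nc; case: (ltgtP I K) => IK; case: (ltgtP J L) => JL; try by lia.
- by exfalso; apply: nc; left; split; [lia|right].
- by exfalso; apply: nc; right; split; [lia|right].
Qed.

Lemma interleave_meet c d I J K L : lifts c I J -> lifts d K L ->
  interleave I J K L ->
  curve c `&` curve d `&` @open_punctured_disc R !=set0.
Proof.
move=> cIJ dKL [/andP[IK KJ] KL].
have [t [h1 h2 h3]] : exists t : R, [/\ I%:~R < t < J%:~R, K%:~R <= t <= L%:~R
    & K = L \/ (t - I%:~R) * (J%:~R - t) = (t - K%:~R) * (L%:~R - t)].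
  have IK' : I%:~R < K%:~R :> R by rewrite ltr_int.
  have KJ' : K%:~R < J%:~R :> R by rewrite ltr_int.
  case: KL => [<-|JL].
    by exists K%:~R; split; rewrite ?lexx ?IK' //; left.
  have JL' : J%:~R < L%:~R :> R by rewrite ltr_int.
  move: IK' KJ' JL'; set i := I%:~R; set j := J%:~R; set k := K%:~R; set l := L%:~R.
  move=> ik kj jl.
  have D0 : 0 < k + l - i - j by lra.
  (* The squares cancel in the equation of the two parabolas, leaving a linear equation with this
     root. *)
  set t := (k * l - i * j) / (k + l - i - j).
  have tE : t * (k + l - i - j) = k * l - i * j by rewrite divfK // gt_eqF.
  have kt : k < t by rewrite ltr_pdivlMr //; nra.
  have tj : t < j by rewrite ltr_pdivrMr //; nra.
  exists t; split; [lra|lra|right].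
  have : (t - i) * (j - t) - (t - k) * (l - t) = (k * l - i * j) - t * (k + l - i - j) by ring.
  by rewrite tE subrr => /eqP; rewrite subr_eq0 => /eqP.
have y0 : 0 < (t - I%:~R) * (J%:~R - t) by case/andP: h1 => *; rewrite mulr_gt0 ?subr_gt0.
set r := (1 + (t - I%:~R) * (J%:~R - t))^-1.
have r0 : 0 < r by rewrite invr_gt0; lra.
have r1 : r < 1 by rewrite invf_lt1; lra.
have op : open_punctured_disc (polar n t r) by apply/open_punctured_polar.
have p0 := open_punctured_neq0 op.
exists (polar n t r); split => //; split.
- apply/(lifts_curve cIJ p0); exists t, r; split => //; first by rewrite r0 ltW.
    by case/andP: h1 => *; rewrite !ltW.
  by right; rewrite invrK.
- apply/(lifts_curve dKL p0); exists t, r; split => //; first by rewrite r0 ltW.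
  by case: h3 => [->|h]; [left|right; rewrite invrK h].
Qed.

(** Turns the geometric condition into combinatorics. Interleaving lifts meet in the interior;
    conversely a common interior point lies on two lifts over the same [t], which either interleave
    or coincide, and coinciding lifts come from equal arcs. *)
Lemma noncrossingP (c d : disc_arc n) : c != d ->
  noncrossing R c d <->
  forall I J K L, lifts (val c) I J -> lifts (val d) K L -> ~ crossing I J K L.
Proof.
move=> cd; split=> [nc I J K L cIJ dKL [/(interleave_meet cIJ dKL)|/(interleave_meet dKL cIJ)]|H].
- by rewrite nc => -[].
- by rewrite (setIC (curve (val d))) nc => -[].
rewrite /noncrossing -subset0 => p [[cp dp] op].
have p0 := open_punctured_neq0 op.
have [I [J cIJ]] : exists I J, lifts (val c) I J.
  case: (val c) => [j|[i j]]; first by exists j, j; split=> //; exists 0; rewrite mul0r addr0.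
  by exists i, (clockwise_end i j), 0; rewrite mul0r !addr0.
have [K0 [L0 dKL0]] : exists I J, lifts (val d) I J.
  case: (val d) => [j|[i j]]; first by exists j, j; split=> //; exists 0; rewrite mul0r addr0.
  by exists i, (clockwise_end i j), 0; rewrite mul0r !addr0.
have [t [r [/andP[r0 r1] pE tIJ rI]]] := (lifts_curve cIJ p0).1 cp.
have [t' [r' [/andP[r'0 _] pE' tKL rK]]] := (lifts_curve dKL0 p0).1 dp.
have [rr [z tt]] := polar_inj n0 r0 r'0 (etrans (esym pE) pE').
subst r' t'.
(* The lift of [d] is moved by whole periods so that both lifts pass over the same [t]. *)
set K : int := K0 + (- z) * n%:Z; set L : int := L0 + (- z) * n%:Z.
have dKL : lifts (val d) K L by exact: liftsD.
have eK : K%:~R = K0%:~R - (z * n%:Z)%:~R :> R by rewrite /K mulNr intrB.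
have eL : L%:~R = L0%:~R - (z * n%:Z)%:~R :> R by rewrite /L mulNr intrB.
have {}tKL : K%:~R <= t <= L%:~R by rewrite eK eL lerBlDr lerBrDr.
have {}rK : K = L \/ r^-1 = 1 + (t - K%:~R) * (L%:~R - t).
  case: rK => [KL|->]; first by left; rewrite /K KL.
  by right; rewrite eK eL; ring.
clearbody K L; clear eK eL.
(* Positive height places [t] strictly inside any nondegenerate interval whose curve carries the
   point. *)
have r1' : 1 < r^-1 by rewrite invf_gt1 //; apply/(open_punctured_polar t r0); rewrite -pE.
have nIJ := H _ _ _ _ cIJ dKL.
have IKne : ~ (I = K /\ J = L).
  case=> IK JL; move/eqP: cd; apply; apply: val_inj.
  by apply: (lifts_inj cIJ); rewrite IK JL.
case/andP: tIJ => It tJ; case/andP: tKL => Kt tL.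
have [IJ|] := eqVneq I J; have [KL|] := eqVneq K L.
- apply: IKne; rewrite -IJ -KL; suff : I%:~R = K%:~R :> R by move/intr_inj.
  by rewrite -IJ in tJ; rewrite -KL in tL; lra.
- move=> /eqP nKL; case: rK => // rK; rewrite -IJ in tJ.
  have tI : t = I%:~R by lra.
  rewrite rK tI in r1'; have : 0 < (I%:~R - K%:~R) * (L%:~R - I%:~R) :> R by lra.
  rewrite tI in Kt tL; move=> pos.
  have [] := mulr_gt0_ge0 _ _ pos; rewrite ?subr_ge0 // !subr_gt0.
  by rewrite !ltr_int => h1 h2; apply: nIJ; right; split; [rewrite h1 h2|left].
- move=> /eqP nIJ'; case: rI => // rI; rewrite -KL in tL.
  have tK : t = K%:~R by lra.
  rewrite rI tK in r1'; have : 0 < (K%:~R - I%:~R) * (J%:~R - K%:~R) :> R by lra.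
  rewrite tK in It tJ; move=> pos.
  have [] := mulr_gt0_ge0 _ _ pos; rewrite ?subr_ge0 // !subr_gt0.
  by rewrite !ltr_int => h1 h2; apply: nIJ; left; split; [rewrite h1 h2|left].
move=> /eqP nKL /eqP nIJ'; case: rI => // rI; case: rK => // rK.
have posI : 0 < (t - I%:~R) * (J%:~R - t) by lra.
have posK : 0 < (t - K%:~R) * (L%:~R - t) by lra.
have e : (t - I%:~R) * (J%:~R - t) = (t - K%:~R) * (L%:~R - t) by lra.
have [It' tJ'] : I%:~R < t /\ t < J%:~R.
  by have [] := mulr_gt0_ge0 _ _ posI; rewrite ?subr_ge0 // !subr_gt0.
have [Kt' tL'] : K%:~R < t /\ t < L%:~R.
  by have [] := mulr_gt0_ge0 _ _ posK; rewrite ?subr_ge0 // !subr_gt0.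
have IL : I < L by rewrite -(ltr_int R); lra.
have KJ : K < J by rewrite -(ltr_int R); lra.
apply: IKne; have [[h1 h2]|[h1 h2]] := crossing_nested IL KJ nIJ.
- have [] := nested_parabola_eq _ Kt' tL' _ e; rewrite ?ler_int //.
  by move=> /intr_inj -> /intr_inj ->.
- have [] := nested_parabola_eq _ It' tJ' _ (esym e); rewrite ?ler_int //.
  by move=> /intr_inj -> /intr_inj ->.
Qed.

End Lifts.

(** * From a triangulation of the disc to the unrolled strip *)

Section LiftedTriangulation.
Variables (R : realType) (n : nat).
Hypothesis n0 : (0 < n)%N.
Variable Pi : {set disc_arc n}.

Definition has_lift (I J : int) : Prop :=
  exists2 c, c \in Pi & lifts (val c) I J.

(** Boundary segments are not arcs and are added here as sides of triangles; [I < J] leaves out the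
    radii. *)
Definition side (I J : int) : bool :=
  `[< J = I + 1 \/ I < J /\ has_lift I J >].

Definition spoke (k : int) : bool := `[< has_lift k k >].

Lemma has_liftD (I J z : int) : has_lift (I + z * n%:Z) (J + z * n%:Z) <-> has_lift I J.
Proof.
split=> -[c cPi cIJ]; exists c => //; last exact: liftsD.
by have := liftsD n0 (- z) cIJ; rewrite mulNr !addrK.
Qed.

Lemma sideD (I J : int) : side (I + n%:Z) (J + n%:Z) = side I J.
Proof.
have h := has_liftD I J 1; rewrite mul1r in h.
apply: asbool_equiv_eq; rewrite h.
by split; case=> [e|[l k]]; [left; lia|right; split => //; lia|left; lia|right; split => //; lia].
Qed.

Lemma spokeD (k : int) : spoke (k + n%:Z) = spoke k.
Proof. by have h := has_liftD k k 1; rewrite mul1r in h; exact: asbool_equiv_eq. Qed.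

(** Two lifts of one and the same arc are translates by a multiple of [n], and their length is at
    most [n], so they do not interleave either. *)
Lemma pairwise_noncrossing_lifts : pairwise_noncrossing R Pi ->
  forall I J K L, has_lift I J -> has_lift K L -> ~ crossing I J K L.
Proof.
move=> nc I J K L [c cPi cIJ] [d dPi dKL].
have [cd|cd] := eqVneq c d; last exact: (noncrossingP R n0 cd).1 (nc _ _ cPi dPi cd) _ _ _ _ cIJ dKL.
subst d; rewrite /crossing /interleave.
have : L - K = J - I.
  case: (val c) cIJ dKL => [j [-> _] [-> _]|[i j] [y [-> ->]] [z [-> ->]]]; lia.
have : exists z, K = I + z * n%:Z.
  case: (val c) cIJ dKL => [j [_ [y ->]] [_ [z ->]]|[i j] [y [-> _]] [z [-> _]]];
    by exists (z - y); lia.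
have := lifts_le n0 cIJ.
move=> /andP[IJ Jn] [z Kz] LK.
have : z = 0 \/ n%:Z <= z * n%:Z \/ z * n%:Z <= - n%:Z.
  case: (ltgtP z 0) => z0; [right; right|right; left|by left]; nia.
by case=> [z0|]; [rewrite z0 mul0r in Kz|]; lia.
Qed.

(** Adding the arc to [Pi] keeps it pairwise noncrossing, so maximality puts the arc in [Pi]. *)
Lemma maximal_lift (I J : int) : triangulation R Pi ->
  (exists c : disc_arc n, lifts (val c) I J) ->
  (forall K L, has_lift K L -> ~ crossing I J K L) -> has_lift I J.
Proof.
move=> [nc mx] [c cIJ] H; exists c => //.
suff h : pairwise_noncrossing R (c |: Pi).
  by rewrite -(mx _ h (subsetU1 _ _)) setU11.
move=> a b.
have cN d : d \in Pi -> c != d -> noncrossing R c d.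
  move=> dPi cd; apply/noncrossingP => // I' J' K L cIJ' dKL.
  (* Every lift of [c] is a translate of [[I, J]]; translating both lifts back reduces to the
     hypothesis on [[I, J]]. *)
  have [z [-> ->]] : exists z, I' = I + z * n%:Z /\ J' = J + z * n%:Z.
    case: (val c) cIJ cIJ' => [j [<- [y ->]] [<- [z ->]]|[i j] [y [-> ->]] [z [-> ->]]];
    by exists (z - y); lia.
  have := H (K + (- z) * n%:Z) (L + (- z) * n%:Z) ltac:(by exists d => //; exact: liftsD).
  by rewrite /crossing /interleave; lia.
rewrite !in_setU1 => /orP[/eqP->|aP] /orP[/eqP->|bP] ab; first by rewrite eqxx in ab.
- exact: cN.
- by rewrite /noncrossing (setIC (curve _)); apply: cN; rewrite // eq_sym.
- exact: nc.
Qed.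

(** For the maximality clauses, an interval of length between 2 and [n], and likewise every integer,
    is a lift of some arc, to which the maximality of [Pi] applies. *)
Lemma triangulation_lifted : triangulation R Pi ->
  lifted_triangulation n side spoke.
Proof.
move=> T; have nc := pairwise_noncrossing_lifts T.1; split.
- move=> i j /asboolP[->|[ij [c _ /(lifts_le n0)]]]; lia.
- by move=> i; apply/asboolP; left.
- move=> i j k l /asboolP ij /asboolP kl ik kj.
  case: ij => [|[ij Lij]]; first by lia.
  case: kl => [|[kl Lkl]]; first by lia.
  rewrite leNgt; apply/negP => jl; apply: (nc _ _ _ _ Lij Lkl); left.
  by split; [lia|right].
- move=> i j k /asboolP ij /asboolP Bk ik kj.
  case: ij => [|[ij Lij]]; first by lia.
  by apply: (nc _ _ _ _ Lij Bk); left; split; [lia|left].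
split.
- move=> i j ij jn HE HB; apply/asboolP.
  have [->|jne] := eqVneq j (i + 1); [by left|right; split => //].
  apply: maximal_lift => //; first by apply: exists_lift_peripheral => //; lia.
  move=> K L LKL; have [KL|KL] := eqVneq K L.
    have := HB K ltac:(by apply/asboolP; rewrite {2}KL).
    by rewrite /crossing /interleave; lia.
  have KL' : K < L by case: LKL => c _ /(lifts_le n0); lia.
  have := HE K L ltac:(by apply/asboolP; right).
  by rewrite /crossing /interleave; lia.
- move=> k H; apply/asboolP; apply: maximal_lift => //; first exact: exists_lift_radius.
  move=> K L LKL; have [KL|KL] := eqVneq K L.
    by rewrite /crossing /interleave; lia.
  have KL' : K < L by case: LKL => c _ /(lifts_le n0); lia.
  have := H K L ltac:(by apply/asboolP; right).
  by rewrite /crossing /interleave; lia.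
Qed.

End LiftedTriangulation.

(** * Sectors at a marked point *)

(** Supplies a slope in each gap of [C], including the two unbounded ones. *)
Lemma count_lt_exists (R : realFieldType) (C : seq R) (k : nat) :
  uniq C -> (k <= size C)%N ->
  exists2 x : R, x \notin C & count (fun c => c < x) C = k.
Proof.
move=> uC kC; set s := sort <=%O C.
have [x xs <-] : exists2 x : R, x \notin s & count (fun c => c < x) s = k.
  have : sorted <%O s by rewrite lt_sorted_uniq_le sort_uniq uC sort_le_sorted.
  have : (k <= size s)%N by rewrite size_sort.
  (* The lower bound [b] leaves room for [x] to the left of the whole list when [k] is 0. *)
  have : forall b : R, path <%O b s -> (k <= size s)%N ->
      exists2 x, b < x & x \notin s /\ count (fun c => c < x) s = k.
    elim: (s) k {kC} => [|a s' IH] [|k] b //=.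
    - by move=> _ _; exists (b + 1); rewrite ?ltrDl.
    - case/andP=> ba pa _; exists ((a + b) / 2); first by lra.
      have lt_s' c : c \in a :: s' -> (a + b) / 2 < c.
        rewrite inE => /orP[/eqP->|cs]; first by lra.
        by have := order_path_min lt_trans pa => /allP/(_ _ cs) /=; lra.
      split; first by apply/negP => /lt_s'; rewrite ltxx.
      rewrite -[LHS]/(count (fun c => c < (a + b) / 2) (a :: s')).
      rewrite -[RHS](count_pred0 (a :: s')); apply: eq_in_count => c /lt_s' /=; lra.
    - case/andP=> ba pa ks; have [x ax [xs cx]] := IH k a pa ks.
      exists x; first exact: lt_trans ax; split; last by rewrite ax cx.
      by rewrite inE negb_or xs andbT gt_eqF.
  move=> H ks; case: (s) H ks => [|a s'] H ks ss.
    by have [x _ []] := H 0 isT ks; exists x.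
  have [|//|x _ []] := H (a - 1); last by exists x.
  by rewrite /= [path _ _ _]ss andbT; lra.
exists x; first by rewrite mem_sort in xs.
by apply/permP; rewrite perm_sym /s perm_sort.
Qed.

(** Used in contrapositive form: two slopes with equal counts have no element of [C] between
    them. *)
Lemma count_lt_strict (R : realFieldType) (C : seq R) (x y c : R) :
  x <= c -> c < y -> c \in C ->
  (count (fun c => (c < x)%R) C < count (fun c => (c < y)%R) C)%N.
Proof.
move=> xc cy; elim: C => // a s IH; rewrite inE => /orP[/eqP<-|cs] /=.
  rewrite cy ltNge xc /= add0n ltnS; apply: sub_count => z /=; lra.
rewrite -addnS; apply: leq_add; last exact: IH.
by case: ltP => // ax; rewrite (lt_le_trans ax) // (le_trans xc (ltW cy)).
Qed.

(** The bijection evaluates [f] at a chosen point of each component. Components are nonempty, so the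
    default point 0 of [xget] is never taken. *)
Lemma card_components (R : realType) (S : set (R * R)) (f : R * R -> nat) k :
  (forall p, S p -> (f p < k)%N) ->
  (forall p q, S p -> S q -> connected_component S p q <-> f p = f q) ->
  (forall j, (j < k)%N -> exists2 p, S p & f p = j) ->
  (components S #= `I_k)%card.
Proof.
move=> fk cf fs.
have g K : components S K -> forall p, K p -> S p /\ connected_component S p = K.
  move=> [p Sp <-] q cpq; split; first exact: connected_component_sub cpq.
  exact/esym/same_connected_component.
have gK K : components S K -> K (xget 0 K).
  move=> [p Sp <-]; apply: (xgetPex 0); exists p; exact: connected_component_refl.
apply/card_set_bijP; exists (fun K => f (xget 0 K)); split.
- by move=> K cK /=; apply: fk; have [] := g K cK _ (gK K cK).
- move=> K L /[!inE] cK cL e.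
  have [S1 e1] := g K cK _ (gK K cK); have [S2 e2] := g L cL _ (gK L cL).
  by rewrite -e1 -e2; apply: same_connected_component; apply/cf.
- move=> j /= /fs [p Sp <-]; exists (connected_component S p); first by exists p.
  have cK : components S (connected_component S p) by exists p.
  have [S1 e1] := g _ cK _ (gK _ cK); apply/cf => //; rewrite e1.
  exact: connected_component_refl.
Qed.

Lemma path_connected_component (R : realType) (T : topologicalType)
    (S : set T) (g : R -> T) (a b : R) :
  {in `[a, b], continuous g} -> (forall x, x \in `[a, b] -> S (g x)) ->
  forall x y, x \in `[a, b] -> y \in `[a, b] ->
  connected_component S (g x) (g y).
Proof.
move=> cg Sg x y xab yab; exists (g @` `[a, b]%classic).
- split; first by exists x.
  + by move=> _ [z zab <-]; apply: Sg.
  + apply: connected_continuous_connected; first exact: segment_connected.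
    by apply: continuous_in_subspaceT => z /[!inE] zab; apply: cg.
- by exists y.
Qed.

(** The image of a connected set is an interval; if it met both signs it would contain 0. *)
Lemma connected_component_sign (R : realType) (T : topologicalType)
    (S : set T) (h : T -> R) p q :
  {in S, continuous h} -> (forall x, S x -> h x != 0) ->
  connected_component S p q -> (0 < h p) = (0 < h q).
Proof.
move=> ch h0 [K [Kp KS cK] Kq].
have iK : is_interval (h @` K).
  apply/connected_intervalP/connected_continuous_connected => //.
  apply: continuous_in_subspaceT => x /[!inE] Kx; apply: ch; rewrite inE; exact: KS.
have nz x y : K x -> K y -> 0 < h x -> ~~ (0 < h y) -> False.
  move=> Kx Ky hx; rewrite -leNgt => hy.
  have [z Kz] : (h @` K) 0.
    by apply: (iK (h y) (h x)); [exists y|exists x|rewrite hy ltW].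
  by apply/eqP/h0/KS.
by apply/idP/idP => h1; apply: contraT => h2; exfalso; [exact: (nz p q)|exact: (nz q p)].
Qed.

Lemma continuous_at_fst (R : realType) (p : R * R) : {for p, continuous (@fst R R)}.
Proof. by case: p => x y; apply: cvg_fst. Qed.

Lemma continuous_at_snd (R : realType) (p : R * R) : {for p, continuous (@snd R R)}.
Proof. by case: p => x y; apply: cvg_snd. Qed.

Lemma polar_continuous (R : realType) n (a b : R -> R) (x : R) :
  {for x, continuous a} -> {for x, continuous b} ->
  {for x, continuous (fun x => polar n (a x) (b x))}.
Proof.
move=> ca cb; rewrite /polar.
have cc : {for x, continuous (fun x => 2 * pi * a x / n%:R)}.
  by apply: continuousM; [apply: continuousM => //|]; exact: cst_continuous.
have c1 : {for x, continuous (fun x => b x * cos (2 * pi * a x / n%:R))}.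
  by apply: continuousM => //; apply: (continuous_comp cc); exact: continuous_cos.
have c2 : {for x, continuous (fun x => - (b x * sin (2 * pi * a x / n%:R)))}.
  apply: continuousN; apply: continuousM => //.
  by apply: (continuous_comp cc); exact: continuous_sin.
exact: (cvg_pair c1 c2).
Qed.

(** * Angle and height near a marked point *)

Section LocalCoordinates.
Variables (R : realType) (n : nat) (i : R).
Hypothesis n0 : (0 < n)%N.

Let al : R := 2 * pi * i / n%:R.

(** Cartesian coordinates rotated so that the marked point [i] becomes (1, 0); the sign in [loc_y]
    makes angles grow clockwise. *)
Definition loc_x (p : R * R) : R := p.1 * cos al - p.2 * sin al.
Definition loc_y (p : R * R) : R := - (p.2 * cos al + p.1 * sin al).
(** The factor turns radians into units of [t]; the arctangent recovers [t - i] only within a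
    quarter turn of [i]. *)
Definition angle (p : R * R) : R := atan (loc_y p / loc_x p) * (n%:R / (2 * pi)).
Definition height (p : R * R) : R := (Num.sqrt (p.1 ^+ 2 + p.2 ^+ 2))^-1 - 1.

Lemma height_polar (t r : R) : 0 < r -> height (polar n t r) = r^-1 - 1.
Proof. by move=> r0; rewrite /height polar_sqr sqrtr_sqr gtr0_norm. Qed.

Lemma loc_x_polar (t r : R) : loc_x (polar n t r) = r * cos (2 * pi * (t - i) / n%:R).
Proof.
rewrite (_ : 2 * pi * (t - i) / n%:R = 2 * pi * t / n%:R - al); last by rewrite /al; ring.
by rewrite cosB /loc_x /=; ring.
Qed.

Lemma loc_y_polar (t r : R) : loc_y (polar n t r) = r * sin (2 * pi * (t - i) / n%:R).
Proof.
rewrite (_ : 2 * pi * (t - i) / n%:R = 2 * pi * t / n%:R - al); last by rewrite /al; ring.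
by rewrite sinB /loc_y /=; ring.
Qed.

(** One unit of [t] is at most a full turn, so the angle stays below [pi / 4] in absolute value. *)
Lemma small_angle (s : R) : `|s| < 1 / 8 ->
  - (pi / 2) < 2 * pi * s / n%:R < pi / 2.
Proof.
move=> s8; have p0 := @pi_gt0 R.
have n1 : 1 <= n%:R :> R by rewrite ler1n.
rewrite -ltr_norml normrM normfV !normrM (ger0_norm (ltW p0)) !normr_nat.
have h1 : pi * `|s| < pi * (1 / 8) by rewrite ltr_pM2l.
have h2 : pi * 1 <= pi * n%:R :> R by rewrite ler_pM2l.
by rewrite ltr_pdivrMr ?ltr0n //; lra.
Qed.

Lemma loc_x_gt0 (t r : R) : 0 < r -> `|t - i| < 1 / 8 -> 0 < loc_x (polar n t r).
Proof.
by move=> r0 /small_angle h; rewrite loc_x_polar mulr_gt0 // cos_gt0_pihalf.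
Qed.

Lemma angle_polar (t r : R) : 0 < r -> `|t - i| < 1 / 8 ->
  angle (polar n t r) = t - i.
Proof.
move=> r0 /small_angle h; rewrite /angle loc_x_polar loc_y_polar -mulf_div divff ?gt_eqF //.
rewrite mul1r -/(tan _) tanK; last by rewrite in_itv.
have : pi != 0 :> R by rewrite gt_eqF // pi_gt0.
by move: (@pi R) => P P0; field; rewrite P0 pnatr_eq0 -lt0n n0.
Qed.

Lemma angle_continuous (p : R * R) : 0 < loc_x p -> {for p, continuous angle}.
Proof.
move=> x0.
have c1 : {for p, continuous (fun p : R * R => p.1 * cos al)}.
  by apply: continuousM; [exact: continuous_at_fst|exact: cst_continuous].
have c2 : {for p, continuous (fun p : R * R => p.2 * sin al)}.
  by apply: continuousM; [exact: continuous_at_snd|exact: cst_continuous].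
have c3 : {for p, continuous (fun p : R * R => p.2 * cos al)}.
  by apply: continuousM; [exact: continuous_at_snd|exact: cst_continuous].
have c4 : {for p, continuous (fun p : R * R => p.1 * sin al)}.
  by apply: continuousM; [exact: continuous_at_fst|exact: cst_continuous].
have cx : {for p, continuous loc_x} by exact: continuousB.
have cy : {for p, continuous loc_y} by apply: continuousN; exact: continuousD.
apply: continuousM; last exact: cst_continuous.
apply: (@continuous_comp _ _ _ (fun p => loc_y p / loc_x p) atan).
  by apply: continuousM => //; apply: continuousV; rewrite ?gt_eqF.
exact: continuous_atan.
Qed.

Lemma height_continuous (p : R * R) : 0 < p.1 ^+ 2 + p.2 ^+ 2 ->
  {for p, continuous height}.
Proof.
move=> p0.
have c : {for p, continuous (fun p : R * R => p.1 ^+ 2 + p.2 ^+ 2)}.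
  apply: continuousD; apply: continuousM;
    by [exact: continuous_at_fst|exact: continuous_at_snd].
apply: continuousB; last exact: cst_continuous.
apply: continuousV; first by rewrite gt_eqF // sqrtr_gt0.
apply: (@continuous_comp _ _ _ _ Num.sqrt) => //; exact: sqrt_continuous.
Qed.

End LocalCoordinates.

(** * Slopes of the arcs ending at a marked point *)

Section Ends.
Variables (R : realType) (n : nat).
Hypothesis n0 : (0 < n)%N.
Variables (Pi : {set disc_arc n}) (i : 'I_n).

Let I : int := (i : nat)%:Z.

(** On the lift [[i, i + L]] one has [y = s * (L - s)], that is [q = L * s]; the lift [[i - L, i]]
    gives [q = - L * s], and a radius gives [s = 0]. A loop at [i] appears twice, with slopes of
    both signs. *)
Definition ends : seq R :=
  [seq L%:R^-1 | L <- right_ends n (side Pi) I] ++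
  ([seq - L%:R^-1 | L <- left_ends n (side Pi) I] ++ nseq (spoke Pi I) 0).

Lemma size_ends : size ends = (size (right_ends n (side Pi) I) +
  size (left_ends n (side Pi) I) + spoke Pi I)%N.
Proof. by rewrite !size_cat !size_map size_nseq addnA. Qed.

Lemma mem_right_ends L :
  L \in right_ends n (side Pi) I <-> (1 < L)%N /\ has_lift Pi I (I + L%:Z).
Proof.
rewrite mem_filter mem_iota; split.
  case/andP=> /asboolP[|[IL hl]]; last by split => //; lia.
  by lia.
case=> L1 [c cPi cL]; have := lifts_le n0 cL => h.
apply/andP; split; last by lia.
by apply/asboolP; right; split; [lia|exists c].
Qed.

Lemma mem_left_ends L :
  L \in left_ends n (side Pi) I <-> (1 < L)%N /\ has_lift Pi (I - L%:Z) I.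
Proof.
rewrite mem_filter mem_iota; split.
  case/andP=> /asboolP[|[IL hl]]; last by split => //; lia.
  by lia.
case=> L1 [c cPi cL]; have := lifts_le n0 cL => h.
apply/andP; split; last by lia.
by apply/asboolP; right; split; [lia|exists c].
Qed.

Lemma ends_uniq : uniq ends.
Proof.
have r0 c : c \in [seq L%:R^-1 : R | L <- right_ends n (side Pi) I] -> 0 < c.
  by case/mapP => L /mem_right_ends [L1 _] ->; rewrite invr_gt0 ltr0n; lia.
have l0 c : c \in [seq - L%:R^-1 : R | L <- left_ends n (side Pi) I] -> c < 0.
  by case/mapP => L /mem_left_ends [L1 _] ->; rewrite oppr_lt0 invr_gt0 ltr0n; lia.
rewrite !cat_uniq !map_inj_uniq ?filter_uniq ?iota_uniq //=; first last.
- by move=> x y /= /invr_inj/eqP; rewrite eqr_nat => /eqP.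
- by move=> x y /= /oppr_inj/invr_inj/eqP; rewrite eqr_nat => /eqP.
apply/and3P; split.
- rewrite -all_predC; apply/allP => c; rewrite mem_cat => /orP[/l0|] /= h.
    by apply/negP => /r0; lra.
  by move: h; rewrite mem_nseq => /andP[_ /eqP->]; apply/negP => /r0; rewrite ltxx.
- rewrite -all_predC; apply/allP => c /=; rewrite mem_nseq => /andP[_ /eqP->].
  by apply/negP => /l0; rewrite ltxx.
- by case: spoke.
Qed.

Lemma lifts_gap (c : disc_arc n) (J K : int) : lifts (val c) J K -> K != J + 1.
Proof.
case: c => -[j|[j k]] /= h; first by case=> -> _; lia.
by case=> z [-> ->]; lia.
Qed.

(* Any arc passing over [i] has height at least (7 / 8) ^ 2 > 1 / 4 there. *)
Lemma arcs_near (t r : R) : 0 < r <= 1 -> r^-1 - 1 < 1 / 4 -> `|t - i%:R| < 1 / 8 ->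
  let s := t - i%:R in let q := r^-1 - 1 + s ^+ 2 in
  arcs_union Pi (polar n t r) <-> exists2 c, c \in ends & s = c * q.
Proof.
move=> /[dup] r01 /andP[r0 r1] ry; rewrite ltr_norml => /andP[t1 t2] s q.
have y0 : 0 <= r^-1 - 1 by rewrite subr_ge0 invf_ge1.
have q0 : 0 <= q by rewrite addr_ge0 // sqr_ge0.
have p0 : polar n t r != 0.
  apply: contraTneq r0 => e; have := polar_sqr n t r.
  by rewrite e /= expr0n /= addr0 => /esym/eqP; rewrite sqrf_eq0 => /eqP ->; rewrite ltxx.
have iI : i%:R = I%:~R :> R by [].
have s_eq c : c = 0 -> s = 0 -> s = c * q by move=> -> ->; rewrite mul0r.
split.
- case=> c /= cPi ct.
  have [J0 [K0 cJK0]] : exists J K, lifts (val c) J K.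
    case: (val c) => [j|[k j]]; first by exists j, j; split=> //; exists 0; rewrite mul0r addr0.
    by exists k, (clockwise_end k j), 0; rewrite mul0r !addr0.
  have [t' [r' [/andP[r'0 _] pE tJK rJK]]] := (lifts_curve n0 cJK0 p0).1 ct.
  have [rr [z tt]] := polar_inj n0 r0 r'0 pE.
  subst r' t'.
  pose J : int := J0 + (- z) * n%:Z; pose K : int := K0 + (- z) * n%:Z.
  have cJK : lifts (val c) J K by exact: liftsD.
  have eJ : J%:~R = J0%:~R - (z * n%:Z)%:~R :> R by rewrite /J mulNr intrB.
  have eK : K%:~R = K0%:~R - (z * n%:Z)%:~R :> R by rewrite /K mulNr intrB.
  have {}tJK : J%:~R <= t <= K%:~R by rewrite eJ eK lerBlDr lerBrDr.
  have {}rJK : J = K \/ r^-1 = 1 + (t - J%:~R) * (K%:~R - t).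
    case: rJK => [e|->]; first by left; rewrite /J e.
    by right; rewrite eJ eK; ring.
  clearbody J K; clear eJ eK pE cJK0 J0 K0.
  case/andP: tJK => Jt tK.
  (* [t] lies in [[J, K]] and within 1 / 8 of the integer [I], so [I] lies in [[J, K]] too: the arc
     is the radius at [I], starts or ends at [I], or passes over it. *)
  have JI : J <= I.
    rewrite leNgt; apply/negP => IJ.
    have : (I + 1)%:~R <= J%:~R :> R by rewrite ler_int lezD1.
    by rewrite intrD -iI; lra.
  have IK : I <= K.
    rewrite leNgt; apply/negP => KI.
    have : K%:~R <= (I - 1)%:~R :> R by rewrite ler_int lerBrDr lezD1.
    by rewrite intrB -iI; lra.
  have [JK|JKne] := eqVneq J K.
    have JI' : J = I by clear -JI IK JK; lia.
    have spI : spoke Pi I by apply/asboolP; exists c => //; rewrite -{1}JI' -JI' {2}JK.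
    exists 0; first by rewrite !mem_cat spI /= inE eqxx !orbT.
    have tI : t = I%:~R by subst J K; lra.
    by apply: s_eq => //; rewrite /s tI iI subrr.
  case: rJK => [/eqP|re]; first by rewrite (negbTE JKne).
  have gap := lifts_gap cJK; have le := lifts_le n0 cJK.
  have [JI'|JI'] := eqVneq J I.
    have [L L1 KL] : exists2 L : nat, (1 < L)%N & K = I + L%:Z.
      by exists (absz (K - I)%R); clear -IK JI' JKne gap; lia.
    have L0 : L%:R != 0 :> R by rewrite pnatr_eq0 -lt0n ltnW.
    exists L%:R^-1.
      rewrite mem_cat; apply/orP; left; apply: map_f; apply/mem_right_ends.
      by split => //; exists c => //; rewrite -KL -{1}JI'.
    have -> : q = s * L%:R.
      rewrite /q re JI' KL intrD -iI /s; ring.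
    by rewrite mulrCA mulVf ?mulr1.
  have [KI'|KI'] := eqVneq K I.
    have [L L1 KL] : exists2 L : nat, (1 < L)%N & J = I - L%:Z.
      by exists (absz (I - J)%R); clear -JI KI' JKne gap; lia.
    have L0 : L%:R != 0 :> R by rewrite pnatr_eq0 -lt0n ltnW.
    exists (- L%:R^-1).
      rewrite !mem_cat; apply/orP; right; apply/orP; left.
      apply: (map_f (fun L => - L%:R^-1)); apply/mem_left_ends.
      by split => //; exists c => //; rewrite -KL -{1}KI'.
    have -> : q = - s * L%:R.
      rewrite /q re KI' KL intrB -iI /s; ring.
    by field.
  have h1 : 7 / 8 <= t - J%:~R.
    have : J%:~R <= (I - 1)%:~R :> R by rewrite ler_int lerBrDr lezD1 lt_neqAle JI'.
    by rewrite intrB -iI; lra.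
  have h2 : 7 / 8 <= K%:~R - t.
    have : (I + 1)%:~R <= K%:~R :> R by rewrite ler_int lezD1 lt_neqAle eq_sym KI'.
    by rewrite intrD -iI; lra.
  have : (7 / 8) * (7 / 8) <= (t - J%:~R) * (K%:~R - t) by apply: ler_pM => //; lra.
  by rewrite re in ry; lra.
- case=> c + sc; rewrite !mem_cat => /or3P[/mapP[L]|/mapP[L]|].
  + move=> /mem_right_ends [L1 [d dPi dL]] cL; exists d => //.
    apply/(lifts_curve n0 dL p0); exists t, r.
    have L0 : L%:R != 0 :> R by rewrite pnatr_eq0 -lt0n ltnW.
    have L2 : 2 <= L%:R :> R by rewrite ler_nat.
    have s0 : 0 <= s by rewrite sc cL mulr_ge0 // invr_ge0 ler0n.
    split => //; rewrite intrD -iI.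
      by apply/andP; move: s0; rewrite /s => s0; split; [lra|rewrite -[L%:~R]/(L%:R); lra].
    right; have : q = s * L%:R by rewrite sc cL mulrAC mulVf ?mul1r.
    rewrite -[L%:~R]/(L%:R) /q /s => e.
    have -> : r^-1 = r^-1 - 1 + (t - i%:R) ^+ 2 - (t - i%:R) ^+ 2 + 1 by ring.
    by rewrite e; ring.
  + move=> /mem_left_ends [L1 [d dPi dL]] cL; exists d => //.
    apply/(lifts_curve n0 dL p0); exists t, r.
    have L0 : L%:R != 0 :> R by rewrite pnatr_eq0 -lt0n ltnW.
    have L2 : 2 <= L%:R :> R by rewrite ler_nat.
    have s0 : s <= 0 by rewrite sc cL mulNr oppr_le0 mulr_ge0 // invr_ge0 ler0n.
    split => //; rewrite intrB -iI.
      by apply/andP; move: s0; rewrite /s => s0; split; [rewrite -[L%:~R]/(L%:R); lra|lra].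
    right; have : q = - s * L%:R by rewrite sc cL; field.
    rewrite -[L%:~R]/(L%:R) /q /s => e.
    have -> : r^-1 = r^-1 - 1 + (t - i%:R) ^+ 2 - (t - i%:R) ^+ 2 + 1 by ring.
    by rewrite e; ring.
  + rewrite mem_nseq => /andP[sp /eqP c0].
    have /asboolP[d dPi dL] : spoke Pi I by case: spoke sp.
    exists d => //; apply/(lifts_curve n0 dL p0); exists t, r.
    have s0 : s = 0 by rewrite sc c0 mul0r.
    split => //; last by left.
    by rewrite -iI; move: s0; rewrite /s => s0; apply/andP; split; lra.
Qed.

End Ends.

(** * The chart by slope [w] and parameter [q] *)

Section SectorCoordinates.
Variables (R : realType) (e h : R).
Hypotheses (e0 : 0 < e) (e8 : e < 1 / 8) (eh : e <= h).

(** The pair stands for the point with [s = w * q] and [y = q - s ^ 2]. The conditions bound [s] by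
    [e] and the height by [h], and [0 < q] leaves out the marked point. *)
Definition sector_coord (w q : R) : Prop :=
  [/\ 0 < q, `|w * q| < e, 0 <= q - (w * q) ^+ 2 & q - (w * q) ^+ 2 < h].

Lemma sector_coord_scale (w q l : R) : sector_coord w q -> 0 < l -> l <= 1 ->
  sector_coord w (l * q).
Proof.
move: (e0) (e8) (eh) => e0' e8' eh'.
case=> q0 wq y0 yh l0 l1; have lq : 0 < l * q by rewrite mulr_gt0.
rewrite /sector_coord (_ : w * (l * q) = l * (w * q)); last by ring.
move: (w * q) wq y0 yh => s; rewrite ltr_norml => /andP[s1 s2] y0 yh.
have ss : s ^+ 2 < e ^+ 2 by nra.
have lss : l * (l * s ^+ 2) <= l * s ^+ 2.
  by rewrite ler_pM2l // ler_piMl // sqr_ge0.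
have lqss : l * s ^+ 2 <= l * q by rewrite ler_pM2l //; lra.
split => //; rewrite ?exprMn.
- rewrite normrM gtr0_norm //; apply: le_lt_trans (_ : `|s| < e); last by rewrite ltr_norml s1.
  by rewrite ler_piMl.
- by rewrite expr2; lra.
(* The height [l * q - l ^ 2 * s ^ 2] can exceed its value at [l = 1] only if [q < 2 * s ^ 2]; then
   [q] is below [e / 4], hence below [h]. *)
have [qs|qs] := leP ((1 + l) * s ^+ 2) q.
  apply: le_lt_trans yh; rewrite -subr_ge0.
  have -> : q - s ^+ 2 - (l * q - l ^+ 2 * s ^+ 2) = (1 - l) * (q - (1 + l) * s ^+ 2) by ring.
  by rewrite mulr_ge0 ?subr_ge0.
have q2 : q < 2 * s ^+ 2.
  apply: lt_le_trans qs _; apply: ler_wpM2r; [exact: sqr_ge0|lra].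
have lqq : l * q <= q by rewrite ler_piMl // ltW.
have ee : e ^+ 2 < e * (1 / 8) by rewrite expr2 ltr_pM2l.
have ls0 : 0 <= l ^+ 2 * s ^+ 2 by rewrite mulr_ge0 ?sqr_ge0.
lra.
Qed.

(** A single bound on [q] serves all slopes up to [m], which permits sweeping across slopes at
    constant [q]. *)
Lemma sector_coord_small (m : R) : exists2 q : R, 0 < q &
  forall w q', `|w| <= m -> 0 < q' -> q' <= q -> sector_coord w q'.
Proof.
move: (e0) (e8) (eh) => e0' e8' eh'.
pose M := `|m| + 1; have M1 : 1 <= M by rewrite lerDr.
have M0 : 0 < M by lra.
(* As [M] is at least 1, this bound gives [q * M <= e / 2] and [(w * q) ^ 2 <= q / 2], so that [y]
   is nonnegative and at most [q]. *)
exists (e / (2 * M ^+ 2)); first by rewrite divr_gt0 // mulr_gt0 // exprn_gt0.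
move=> w q wm q0; rewrite ler_pdivlMr; last by rewrite mulr_gt0 // exprn_gt0.
move=> qe; have wM : `|w| <= M by have := ler_norm m; rewrite /M; lra.
have MM : M <= M ^+ 2 by rewrite expr2 ler_peMl // ltW.
have qM : q * M <= q * M ^+ 2 by rewrite ler_pM2l.
have q1 : q * 1 <= q * M by rewrite ler_pM2l.
have wq : `|w * q| <= q * M by rewrite normrM mulrC (gtr0_norm q0) ler_pM2l.
have w2 : (w * q) ^+ 2 <= q * (q * M ^+ 2).
  rewrite -(real_normK (num_real (w * q))).
  have -> : q * (q * M ^+ 2) = (q * M) ^+ 2 by ring.
  by rewrite ler_sqr ?nnegrE ?normr_ge0 // mulr_ge0 // ltW.
have qq : q * (q * M ^+ 2) <= q * (1 / 2) by rewrite ler_pM2l //; lra.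
have := sqr_ge0 (w * q); split => //; lra.
Qed.

End SectorCoordinates.

(** * Counting the components near a marked point *)

Section Sectors.
Variables (R : realType) (n : nat).
Hypothesis n0 : (0 < n)%N.
Variables (Pi : {set disc_arc n}) (i : 'I_n) (e : R).
Hypotheses (e0 : 0 < e) (e8 : e < 1 / 8).

Let C : seq R := ends R Pi i.
Let h : R := (1 - e)^-1 - 1.
Let S : set (R * R) := (@disc R `\` arcs_union Pi) `&` small_nbhd i e.

Let eh : e <= h.
Proof.
move: (e0) (e8) (sqr_ge0 e) => e0' e8' ee.
by rewrite lerBrDr -[leRHS]mul1r ler_pdivlMr; lra.
Qed.

Let h4 : h < 1 / 4.
Proof.
move: (e0) (e8) => e0' e8'; rewrite ltrBlDr -[ltLHS]mul1r ltr_pdivrMr; lra.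
Qed.

Lemma near_radius r : 1 - e < r -> r <= 1 ->
  [/\ 0 < r, 0 <= r^-1 - 1 & r^-1 - 1 < h].
Proof.
move: (e0) (e8) => e0' e8' r1 r2; have r0 : 0 < r by lra.
split => //; first by rewrite subr_ge0 invf_ge1.
by rewrite ltrD2r ltf_pV2 // posrE; lra.
Qed.

Lemma mem_sectors p : S p <-> exists t r : R, [/\ `|t - i%:R| < e, 1 - e < r <= 1,
  p = polar n t r & forall c, c \in C ->
    t - i%:R != c * (r^-1 - 1 + (t - i%:R) ^+ 2)].
Proof.
have bd t : (t \in `]i%:R - e, i%:R + e[) = (`|t - i%:R| < e).
  by rewrite in_itv /= ltr_distl.
split.
- case=> [[dp Up] [t /= + [r /= + pE]]]; rewrite bd in_itv /= => te /[dup] re /andP[r1 r2].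
  have [r0 y0 yh] := near_radius r1 r2.
  exists t, r; split => // c cC; apply/eqP => sc; apply: Up; rewrite -pE.
  apply/(arcs_near n0 Pi (i := i)); [by rewrite r0|exact: lt_trans h4|exact: lt_trans e8|].
  by exists c.
- case=> t [r [te /[dup] re /andP[r1 r2] pE cC]].
  have [r0 y0 yh] := near_radius r1 r2.
  split; last by exists t; [rewrite /= bd|exists r; rewrite //= in_itv].
  split; first by rewrite pE /disc /= polar_sqr expr_le1 // ltW.
  rewrite pE => /(arcs_near n0 Pi (i := i)); rewrite r0 r2.
  case=> //; [exact: lt_trans h4|exact: lt_trans e8|] => c cE sc.
  by have := cC c cE; rewrite -sc eqxx.
Qed.

(** In local coordinates [g c] is [s - c * q], which vanishes on the arc end of slope [c]; [sector]
    counts the arc ends that have the point on their clockwise side. *)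
Let g (c : R) (p : R * R) : R :=
  angle n i%:R p - c * (height p + angle n i%:R p ^+ 2).

Let sector (p : R * R) : nat := count (fun c => 0 < g c p) C.

Lemma g_polar c t r : `|t - i%:R| < e -> 1 - e < r <= 1 ->
  g c (polar n t r) = (t - i%:R) - c * (r^-1 - 1 + (t - i%:R) ^+ 2).
Proof.
move=> te /andP[r1 r2]; have [r0 _ _] := near_radius r1 r2.
by rewrite /g angle_polar // ?height_polar // (lt_trans te).
Qed.

(** Each [g c] with [c] in [C] is continuous and has no zero on [S], so its sign is constant on a
    component. *)
Lemma sector_connected p q : connected_component S p q -> sector p = sector q.
Proof.
move=> cpq; apply: eq_in_count => c cC; apply: (connected_component_sign _ _ cpq).
- move=> x; rewrite inE => /mem_sectors [t [r [te /andP[r1 r2] -> _]]].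
  have [r0 _ _] := near_radius r1 r2.
  have ca : {for polar n t r, continuous (angle n i%:R : R * R -> R)}.
    by apply: angle_continuous; apply: loc_x_gt0; rewrite // (lt_trans te).
  have ch : {for polar n t r, continuous (@height R)}.
    by apply: height_continuous; rewrite polar_sqr exprn_gt0.
  apply: continuousB => //; apply: continuousM; first exact: cst_continuous.
  by apply: continuousD => //; apply: continuousM.
- move=> x /mem_sectors [t [r [te re -> H]]].
  by rewrite g_polar // subr_eq0 H.
Qed.

Let pt (w q : R) : R * R := polar n (i%:R + w * q) (1 + (q - (w * q) ^+ 2))^-1.

Lemma radius_bounds y : 0 <= y -> y < h -> 1 - e < (1 + y)^-1 <= 1.
Proof.
move: (e0) (e8) => e0' e8' y0 yh; rewrite invf_le1 ?lerDl; last by lra.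
rewrite y0 andbT -[ltLHS]invrK ltf_pV2 ?posrE ?invr_gt0; try lra.
by move: yh; rewrite /h; lra.
Qed.

Lemma pt_sectors w q : sector_coord e h w q -> w \notin C -> S (pt w q).
Proof.
case=> q0 wq y0 yh wC; apply/mem_sectors.
exists (i%:R + w * q), (1 + (q - (w * q) ^+ 2))^-1.
rewrite addrAC subrr add0r; split => //; first exact: radius_bounds.
move=> c cC; rewrite invrK; apply: contra wC => /eqP.
rewrite (_ : 1 + (q - (w * q) ^+ 2) - 1 + (w * q) ^+ 2 = q); last by ring.
by move=> /(mulIf (lt0r_neq0 q0)) ->.
Qed.

Lemma sector_pt w q : sector_coord e h w q ->
  sector (pt w q) = count (fun c => c < w) C.
Proof.
case=> q0 wq y0 yh; apply: eq_count => c.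
rewrite g_polar; last 2 first.
- by rewrite addrAC subrr add0r.
- exact: radius_bounds.
rewrite (_ : i%:R + w * q - i%:R = w * q) ?invrK; last by ring.
rewrite (_ : 1 + (q - (w * q) ^+ 2) - 1 + (w * q) ^+ 2 = q); last by ring.
by rewrite -mulrBl pmulr_lgt0 // subr_gt0.
Qed.

(** The slope is [s / q]. Only the marked point has [q = 0], and it is removed as soon as one arc
    ends there. *)
Lemma sectors_pt p : C != [::] -> S p ->
  exists w q, [/\ sector_coord e h w q, w \notin C & p = pt w q].
Proof.
move=> C0 /mem_sectors [t [r [te /andP[r1 r2] pE H]]].
have [r0 y0 yh] := near_radius r1 r2.
set s := t - i%:R in te H; set y := r^-1 - 1 in y0 yh H; set q := y + s ^+ 2 in H.
have q0 : 0 < q.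
  rewrite lt_def addr_ge0 ?sqr_ge0 // andbT; apply/eqP => q0.
  have /eqP : q == 0 by rewrite q0.
  move/eqP; rewrite paddr_eq0 ?sqr_ge0 // sqrf_eq0 => /andP[_ /eqP s0].
  have [c cC] : exists c, c \in C by case: (C) C0 => // c l _; exists c; rewrite mem_head.
  by have := H c cC; rewrite q0 mulr0 s0 eqxx.
have wq : s / q * q = s by rewrite divfK // gt_eqF.
have qy : q - s ^+ 2 = y by rewrite addrK.
exists (s / q), q; split.
- by split; rewrite ?wq ?qy.
- by apply/negP => /H; rewrite wq eqxx.
- by rewrite pE /pt wq qy /s /y addrC subrK addrC subrK invrK.
Qed.

Lemma pt_continuous (a b : R -> R) x : {for x, continuous a} ->
  {for x, continuous b} -> sector_coord e h (a x) (b x) ->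
  {for x, continuous (fun x => pt (a x) (b x))}.
Proof.
move=> ca cb [q0 wq y0 yh].
have cab : {for x, continuous (fun x => a x * b x)} by exact: continuousM.
apply: (@polar_continuous R n (fun x => i%:R + a x * b x)
  (fun x => (1 + (b x - (a x * b x) ^+ 2))^-1)).
  by apply: continuousD => //; exact: cst_continuous.
apply: continuousV; first by rewrite gt_eqF //; lra.
apply: continuousD; first exact: cst_continuous.
by apply: continuousB => //; apply: continuousM.
Qed.

(** The path shrinks [q] along the line of slope [w1], sweeps from [w1] to [w2] at a constant [q]
    small enough for all slopes in between, and then grows [q] along the line of slope [w2]. *)
Lemma pt_connected w1 q1 w2 q2 :
  sector_coord e h w1 q1 -> sector_coord e h w2 q2 ->
  (forall w, w1 <= w <= w2 -> w \notin C) -> w1 <= w2 ->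
  connected_component S (pt w1 q1) (pt w2 q2).
Proof.
move=> D1 D2 wC w12.
have shrink w q l : sector_coord e h w q -> w \notin C -> 0 < l -> l <= 1 ->
    connected_component S (pt w q) (pt w (l * q)).
  move=> D wC' l0 l1; rewrite -{1}[q]mul1r.
  apply: (@path_connected_component R _ S (fun x => pt w (x * q)) l 1);
    rewrite ?in_itv /= ?lexx ?l1 // => x.
    rewrite in_itv /= => /andP[lx x1]; apply: (@pt_continuous (fun=> w) (fun x => x * q)); first exact: cst_continuous.
      by apply: continuousM; [exact: cvg_id|exact: cst_continuous].
    by apply: sector_coord_scale => //; exact: lt_le_trans lx.
  rewrite in_itv /= => /andP[lx x1]; apply: pt_sectors => //.
  by apply: sector_coord_scale => //; exact: lt_le_trans lx.
have [q3 q30 small] := sector_coord_small e0 e8 eh (`|w1| + `|w2|).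
have [q10 _ _ _] := D1; have [q20 _ _ _] := D2.
pose q := Num.min (Num.min q1 q2) q3.
have q0 : 0 < q by rewrite !lt_min q10 q20 q30.
have qq1 : q <= q1 by rewrite !ge_min lexx.
have qq2 : q <= q2 by rewrite !ge_min lexx orbT.
have qq3 : q <= q3 by rewrite !ge_min lexx !orbT.
have C1 : w1 \notin C by apply: wC; rewrite lexx.
have C2 : w2 \notin C by apply: wC; rewrite lexx w12.
have e1 : q = q / q1 * q1 by rewrite divfK // gt_eqF.
have e2 : q = q / q2 * q2 by rewrite divfK // gt_eqF.
apply: (@connected_component_trans _ _ (pt w1 q)).
  by rewrite e1; apply: shrink; rewrite ?divr_gt0 ?ler_pdivrMr ?mul1r.
apply: (@connected_component_trans _ _ (pt w2 q)); last first.
  apply: connected_component_sym.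
  by rewrite e2; apply: shrink; rewrite ?divr_gt0 ?ler_pdivrMr ?mul1r.
have D w : w1 <= w <= w2 -> sector_coord e h w q.
  move=> /andP[h1 h2]; apply: small => //.
  have := ler_norm w2; have := ler_norm (- w1); rewrite normrN ler_norml.
  have := normr_ge0 w2; have := normr_ge0 w1; lra.
apply: (@path_connected_component R _ S (fun x => pt x q) w1 w2);
    rewrite ?in_itv /= ?lexx ?w12 // => x; rewrite in_itv /= => hx.
- by apply: (@pt_continuous id (fun=> q)); [exact: cvg_id|exact: cst_continuous|exact: D].
- by apply: pt_sectors; [exact: D|exact: wC].
Qed.

Lemma sectors_connected p q : S p -> S q -> sector p = sector q ->
  connected_component S p q.
Proof.
(* If no arc ends at [i], the marked point belongs to [S] and has no slope; two points are then
   joined by a segment in the coordinates [t] and [r], which range over a rectangle. *)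
have [C0|C0] := eqVneq C [::].
  move=> /mem_sectors [t1 [r1 [te1 re1 -> _]]] /mem_sectors [t2 [r2 [te2 re2 -> _]]] _.
  pose a (x : R) : R := t1 + x * (t2 - t1); pose b (x : R) : R := r1 + x * (r2 - r1).
  have -> : polar n t1 r1 = polar n (a 0) (b 0) by rewrite /a /b !mul0r !addr0.
  have -> : polar n t2 r2 = polar n (a 1) (b 1) by rewrite /a /b !mul1r !(addrC _ (_ - _)) !subrK.
  have ca (u v x : R) : {for x, continuous (fun x : R => u + x * v)}.
    apply: continuousD; first exact: cst_continuous.
    by apply: continuousM; [exact: cvg_id|exact: cst_continuous].
  apply: (@path_connected_component R _ S (fun x => polar n (a x) (b x)) 0 1);
    rewrite ?in_itv /= ?lexx ?ler01 // => x.
    by move=> _; apply: polar_continuous; exact: ca.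
  rewrite in_itv /= => /andP[x0 x1]; apply/mem_sectors; exists (a x), (b x).
  have cvx (u v : R) : u <= u + x * (v - u) <= v \/ v <= u + x * (v - u) <= u.
    have [uv|vu] := leP u v; [left|right].
      have h1 : 0 <= x * (v - u) by rewrite mulr_ge0 ?subr_ge0.
      have h2 : x * (v - u) <= v - u by rewrite ler_piMl ?subr_ge0.
      by apply/andP; split; lra.
    have h1 : 0 <= x * (u - v) by rewrite mulr_ge0 ?subr_ge0 // ltW.
    have h2 : x * (u - v) <= u - v by rewrite ler_piMl ?subr_ge0 // ltW.
    by apply/andP; split; lra.
  split => //; last by rewrite C0.
  - move: te1 te2; rewrite !ltr_distl => /andP[h1 h2] /andP[h3 h4'].
    by case: (cvx t1 t2) => /andP[h5 h6]; rewrite /a; apply/andP; split; lra.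
  - case/andP: re1 => h1 h2; case/andP: re2 => h3 h4'.
    by case: (cvx r1 r2) => /andP[h5 h6]; rewrite /b; apply/andP; split; lra.
move=> /(sectors_pt C0)[w1 [q1 [D1 C1 ->]]] /(sectors_pt C0)[w2 [q2 [D2 C2 ->]]].
rewrite !sector_pt //.
wlog w12 : w1 q1 D1 C1 w2 q2 D2 C2 / w1 <= w2.
  move=> H; have [w12|/ltW w12] := leP w1 w2; first exact: H.
  by move=> /esym e12; apply: connected_component_sym; exact: H.
(* An arc end with slope between [w1] and [w2] would make the two counts differ. *)
move=> e12; apply: pt_connected => // w /andP[h1 h2].
apply/negP => wC; have w2ne : w != w2 by apply: contraNneq C2 => <-.
have ww2 : w < w2 by rewrite lt_neqAle w2ne.
by have := count_lt_strict h1 ww2 wC; rewrite e12 ltnn.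
Qed.

(** [sector] separates the components and takes every value from 0 to [size C]: a slope in the
    corresponding gap, at small [q], realizes each value. *)
Lemma components_sectors : (components S #= `I_(size C).+1)%card.
Proof.
apply: (card_components (f := sector)).
- by move=> p _; rewrite ltnS count_size.
- by move=> p q Sp Sq; split; [exact: sector_connected|exact: sectors_connected].
move=> j jC; have [w wC <-] := count_lt_exists (ends_uniq R n0 Pi i) jC.
have [q q0 /(_ w q)] := sector_coord_small e0 e8 eh `|w|.
rewrite !lexx => /(_ isT q0 isT) D.
by exists (pt w q); [exact: pt_sectors|exact: sector_pt].
Qed.

End Sectors.

(** For every [e] below 1 / 8 the number of components is the same, so [xget] finds it; uniqueness
    compares two candidates at one common [e]. *)
Lemma quiddityE (R : realType) (n : nat) (n0 : (0 < n)%N)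
    (Pi : {set disc_arc n}) (i : 'I_n) :
  quiddity R Pi i = (size (ends R Pi i)).+1.
Proof.
have near8 : \forall e \near (0 : R)^'+, 0 < e < 1 / 8.
  near=> e; apply/andP; split => //; near: e; apply: nbhs_right_lt; lra.
rewrite /quiddity; apply: xget_unique.
- near=> e; have /andP[e0 e8] : 0 < e < 1 / 8 by near: e.
  exact: components_sectors.
- move=> k /= hk; apply/card_eq_II.
  near (0 : R)^'+ => e; have /andP[e0 e8] : 0 < e < 1 / 8 by near: e.
  have := components_sectors n0 Pi i e0 e8.
  have : (components ((@disc R `\` arcs_union Pi) `&` small_nbhd i e) #= `I_k)%card.
    by near: e.
  by rewrite card_eq_sym; exact: card_eq_trans.
Unshelve. all: by end_near. Qed.

Theorem theorem3p6 (R : realType) (n : nat) (hn : (0 < n)%N)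
    (Pi : {set disc_arc n}) (hPi : @triangulation R n Pi) :
  exists m : int -> int -> int,
    [/\ infinite_frieze m, frieze_periodic n m
      & frieze_quiddity m (@quiddity R n Pi)].
Proof.
have EB := triangulation_lifted hn hPi.
have [v [v0 vB vT]] := triangle_label EB.
(* The ordinal [i] has label [i.+1], hence the shift by one. *)
pose a (k : int) : int := (size (right_ends n (side Pi) (k - 1)) +
  size (left_ends n (side Pi) (k - 1)) + spoke Pi (k - 1) + 1)%:Z.
have rD k : right_ends n (side Pi) (k + n%:Z) = right_ends n (side Pi) k.
  by apply: eq_filter => L; rewrite addrAC sideD.
have lD k : left_ends n (side Pi) (k + n%:Z) = left_ends n (side Pi) k.
  by apply: eq_filter => L; rewrite addrAC sideD.
have aD k : a (k + n%:Z) = a k by rewrite /a addrAC spokeD // rD lD.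
have [|m [fm pm ma]] := @frieze_of_positive_solution n a (fun k => v (k - 1)) aD (fun k => v0 _).
  move=> k; have := label_recurrence hn EB vB vT (k - 1).
  by rewrite subrK addrK.
exists m; split => // i; rewrite ma quiddityE // size_ends /a.
by rewrite intS (addrC 1) addrK addn1.
Qed.
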